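(* Let $0<\alpha\le1$, $\nu>0$, $0<\xi<1$, and let $\Phi^{(n)}(t)$ be the state probabilities of the Prabhakar discrete-time process (PDTP) with parameters $\alpha,\nu,\xi$, with the convention $\Phi^{(n)}(t)=0$ if $n<0$ or $t<0$. Define, for $t\in\mathbb{N}_0$, $$\mathcal{B}(t)=\sum_{m=0}^{\infty}\frac{(-\nu)_m}{m!}(-\xi)^m\,\frac{(\alpha m+\lceil\alpha\nu\rceil-\alpha\nu)_t}{t!},\qquad \mathcal{K}(t)=\xi^{-\nu}\left((1-\hat T)^{\lceil\alpha\nu\rceil-1}\mathcal{B}\right)(t),$$ with $\mathcal{B}(t)=0$ for $t<0$. Then $\mathcal{K}(t)$ is the coefficient of $u^t$ in the power series at $u=0$ of $\frac{1}{1-u}\left(1+\frac{(1-u)^{\alpha}}{\xi}\right)^{\nu}$, and the state probabilities satisfy the generalized fractional Kolmogorov-Feller difference equations $$(1-\hat T)\sum_{k=0}^{t}\mathcal{K}(k)\,\Phi^{(n)}(t-k)=\Phi^{(n-1)}(t-1)+\delta_{n0}\left(\mathcal{K}(t)-\Theta(t-1)\right),\qquad n,t\in\mathbb{N}_0,$$ where on the left $1-\hat T$ acts on the sum as a function of $t$ (which is $0$ for $t<0$).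
   Context: $\mathbb{N}_0=\{0,1,2,\dots\}$; $(c)_0=1$, $(c)_m=c(c+1)\cdots(c+m-1)$; $\lceil x\rceil$ is the smallest integer $\ge x$. $\hat T$ is the backward shift on functions on $\mathbb{Z}$: $(\hat Tg)(t)=g(t-1)$. $\Theta(t)=1$ for integers $t\ge0$ and $\Theta(t)=0$ for $t<0$. $\delta_{n0}$ is the Kronecker symbol. The PDTP with parameters $\alpha,\nu,\xi$ is the discrete-time renewal process with arrival times $J_0=0$, $J_n=\sum_{j=1}^nZ_j$, where the $Z_j$ are i.i.d. $\{1,2,\dots\}$-valued with generating function $\mathbb{E}u^{Z_j}=\frac{\xi^{\nu}u}{(\xi+(1-u)^{\alpha})^{\nu}}$, $|u|\le 1$ (principal branches). Its state probabilities are $\Phi^{(n)}(t)=\mathbb{P}(J_n\le t<J_{n+1})$ for $n,t\in\mathbb{N}_0$. *)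

(* Defs.v *)
From HB Require Import structures.
From mathcomp Require Import all_boot all_order all_algebra.
From mathcomp Require Import finmap complex.
From mathcomp Require Import all_classical all_reals all_analysis.

Set Implicit Arguments.
Unset Strict Implicit.
Unset Printing Implicit Defensive.

Import Order.TTheory GRing.Theory Num.Theory.
Import numFieldNormedType.Exports.

Local Open Scope classical_set_scope.
Local Open Scope ring_scope.
Local Open Scope complex_scope.

(* Principal argument, with values in ]-pi, pi] for z != 0.  As [`|z|] lives in
   R[i], its real part is the modulus as an element of R. *)
Definition carg (R : realType) (z : R[i]) : R :=
  let th := acos (complex.Re z / complex.Re `|z|) in
  if 0 <= complex.Im z then th else - th.

(* Principal branch of z ^ a for a real exponent a.  Since powR 0 a = 0 for
   a != 0, this gives 0 ^ a = 0 for a > 0. *)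
Definition cpow (R : realType) (z : R[i]) (a : R) : R[i] :=
  (complex.Re `|z| `^ a)%:C * (cos (a * carg z) +i* sin (a * carg z)).

Definition poch (R : realType) (c : R) (m : nat) : R :=
  \prod_(i < m) (c + i%:R).

Definition backshift (R : realType) (g : int -> R) (t : int) : R := g (t - 1).

Definition bdiff (R : realType) (g : int -> R) (t : int) : R :=
  g t - backshift g t.

Definition Theta (R : realType) (t : int) : R := (0 <= t)%R%:R.

Definition mutually_independent (R : realType) (d : measure_display)
    (T : measurableType d) (P : probability T R) (Z : nat -> T -> nat) : Prop :=
  forall (J : {fset nat}) (A : nat -> set nat),
    fine (P (\bigcap_(j in [set` J]) (Z j @^-1` A j))) =
    \prod_(j <- J) fine (P (Z j @^-1` A j)).

Definition identically_distributed (R : realType) (d : measure_display)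
    (T : measurableType d) (P : probability T R) (Z : nat -> T -> nat) : Prop :=
  forall (i j : nat) (A : set nat), P (Z i @^-1` A) = P (Z j @^-1` A).

(* E[u ^ X] for complex u: real and imaginary parts are integrated separately.
   For |u| <= 1 both integrands are bounded, so the expectations are finite. *)
Definition cgenfun (R : realType) (d : measure_display)
    (T : measurableType d) (P : probability T R) (X : T -> nat) (u : R[i]) :
    R[i] :=
  fine 'E_P[fun w => complex.Re (u ^+ X w)] +i*
  fine 'E_P[fun w => complex.Im (u ^+ X w)].

Definition PDTP_genfun (R : realType) (alpha nu xi : R) (u : R[i]) : R[i] :=
  (xi `^ nu)%:C * u / cpow (xi%:C + cpow (1 - u) alpha) nu.

(* The waiting times Z_1, Z_2, ... are represented by Z 0, Z 1, ... *)
Definition is_PDTP (R : realType) (alpha nu xi : R) (d : measure_display)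
    (T : measurableType d) (P : probability T R) (Z : nat -> T -> nat) : Prop :=
  [/\ forall j, measurable_fun setT (Z j),
      forall j w, (0 < Z j w)%N,
      mutually_independent P Z,
      identically_distributed P Z
    & forall j (u : R[i]), `|u| <= 1 ->
        cgenfun P (Z j) u = PDTP_genfun alpha nu xi u].

Definition arrival (T : Type) (Z : nat -> T -> nat) (n : nat) (w : T) : nat :=
  (\sum_(j < n) Z j w)%N.

Definition state_prob (R : realType) (d : measure_display)
    (T : measurableType d) (P : probability T R) (Z : nat -> T -> nat)
    (n t : int) : R :=
  match n, t with
  | Posz n, Posz t =>
      fine (P [set w | (arrival Z n w <= t < arrival Z n.+1 w)%N])
  | _, _ => 0
  end.

Definition Bterm (R : realType) (alpha nu xi : R) (t m : nat) : R :=
  poch (- nu) m / m`!%:R * (- xi) ^+ m *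
  (poch (alpha * m%:R + (Num.ceil (alpha * nu))%:~R - alpha * nu) t / t`!%:R).

Definition Bfun (R : realType) (alpha nu xi : R) (t : int) : R :=
  match t with
  | Posz t => limn (series (Bterm alpha nu xi t))
  | Negz _ => 0
  end.

(* For alpha * nu > 0 the ceiling is at least 1, so passing to nat through
   [absz] and taking the predecessor loses nothing. *)
Definition Kker (R : realType) (alpha nu xi : R) (t : int) : R :=
  xi `^ (- nu) *
  iter (absz (Num.ceil (alpha * nu))).-1 (@bdiff R) (Bfun alpha nu xi) t.

Definition Kgenfun (R : realType) (alpha nu xi : R) (u : R[i]) : R[i] :=
  (1 - u)^-1 * cpow (1 + cpow (1 - u) alpha / xi%:C) nu.

Definition convol (R : realType) (f g : int -> R) (t : int) : R :=
  match t with
  | Posz t => \sum_(k < t.+1) f k%:Z * g (t%:Z - k%:Z)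
  | Negz _ => 0
  end.

(* f is analytic at 0 with Taylor coefficients a. *)
Definition power_series_at0 (R : realType) (a : nat -> R) (f : R[i] -> R[i]) :
    Prop :=
  \forall u \near (0 : R[i]^o),
    (series (fun t => (a t)%:C * u ^+ t) : nat -> R[i]^o) @ \oo --> (f u : R[i]^o).

(* Main.v *)
Require Import Defs.
From HB Require Import structures.
From mathcomp Require Import all_boot all_order all_algebra.
From mathcomp Require Import finmap complex.
From mathcomp Require Import all_classical all_reals all_analysis measurable_realfun.
From mathcomp Require Import zify ring lra.

(* Everything rests on the binomial series
     sum_t (x)_t / t! z^t = (1 - z)^(- x)    (principal branch, |z| < 1, x real).
   To get it without complex differentiation, let B(x) be the left-hand side
   and g(x) = B(- x) (1 - z)^(- x). By Chu-Vandermonde and the Cauchy product g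
   is a homomorphism from (R, +) to C^*, and g(1) = 1. For x in [0, 1] one has
   |B(- x) - 1| <= |z| < 1, so B(- x) and (1 - z)^(- x) have positive real part
   and g(x) <> -1; halving repeatedly gives g(2^-k) = 1, so g = 1 at the dyadic
   numbers and everywhere by continuity at 0.

   Kernel: for |u| < (1 - xi) / 2 the double series defining sum_t B(t) u^t is
   dominated, so the sums may be exchanged (Tannery). The inner sums are
   binomial series in u, the outer one is a binomial series in
   - xi (1 - u)^(- alpha), and each backward difference multiplies by 1 - u.

   Equations: the generating functions of K and of the law p of a waiting time
   have product u / (1 - u), so p * K is the indicator of t >= 1. Since the law
   Q_n of the n-th arrival time is the n-fold convolution power of p and
   (1 - T) Phi^(n) = Q_n - Q_(n+1), convolving with K gives the claim. *)

Set Implicit Arguments.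
Unset Strict Implicit.
Unset Printing Implicit Defensive.

Import Order.TTheory GRing.Theory Num.Theory.
Import numFieldNormedType.Exports.
Local Open Scope classical_set_scope.
Local Open Scope ring_scope.

(** * Limits and series over a numeric field *)

(* A one-constructor wrapper, so that unification never unfolds the topology. *)
Variant tends (K : numFieldType) (u : nat -> K) (l : K) : Prop :=
  Tends of (u : nat -> K^o) @ \oo --> (l : K^o).

Section tends.
Variable K : numFieldType.
Implicit Types (u v : nat -> K) (a b : K).

Lemma tendsP u a :
  tends u a <->
  forall e, 0 < e -> exists N, forall n, (N <= n)%N -> `|u n - a| < e.
Proof.
split.
- move=> [/cvgrPdist_lt ua] e e0; have [N _ HN] := ua e e0.
  by exists N => n Nn; rewrite distrC; exact: HN.
- move=> ua; split; apply/cvgrPdist_lt => e e0; have [N HN] := ua e e0.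
  by exists N => // n Nn; rewrite distrC; exact: HN.
Qed.

Lemma tends_cst a : tends (fun=> a) a.
Proof. by split; exact: cvg_cst. Qed.

Lemma tendsD u v a b :
  tends u a -> tends v b -> tends (fun n => u n + v n) (a + b).
Proof. by move=> [ua] [vb]; split; exact: (cvgD ua vb). Qed.

Lemma tendsM u v a b :
  tends u a -> tends v b -> tends (fun n => u n * v n) (a * b).
Proof. by move=> [ua] [vb]; split; exact: (cvgM ua vb). Qed.

Lemma tendsMl u a c : tends u a -> tends (fun n => c * u n) (c * a).
Proof. by move=> ua; apply: tendsM => //; exact: tends_cst. Qed.

Lemma tendsB u v a b :
  tends u a -> tends v b -> tends (fun n => u n - v n) (a - b).
Proof. by move=> [ua] [vb]; split; exact: (cvgB ua vb). Qed.

Lemma tends_ext u v a : tends u a -> (forall n, u n = v n) -> tends v a.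
Proof. by move=> ua uv; rewrite (_ : v = u) //; apply/funext => n; rewrite uv. Qed.

Lemma tends_near u v a N :
  (forall n, (N <= n)%N -> u n = v n) -> tends u a -> tends v a.
Proof.
move=> uv /tendsP ua; apply/tendsP => e e0; have [M HM] := ua e e0.
exists (maxn M N) => n; rewrite geq_max => /andP[Mn Nn].
by rewrite -uv //; exact: HM.
Qed.

Lemma tends_unique u a b : tends u a -> tends u b -> a = b.
Proof.
move=> /tendsP ua /tendsP ub; apply/eqP; rewrite -subr_eq0; apply/negPn/negP.
rewrite -normr_gt0 => e0.
have e20 : 0 < `|a - b| / 2 by rewrite divr_gt0.
have [N HN] := ua _ e20; have [M HM] := ub _ e20.
have H1 := HN _ (leq_maxl N M); have H2 := HM _ (leq_maxr N M).
have : `|a - b| < `|a - b|.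
  rewrite [X in _ < X]splitr; apply: le_lt_trans (ltrD H1 H2).
  by rewrite (distrC (u _) a); apply: le_trans (ler_normD _ _); rewrite addrA subrK.
by rewrite ltxx.
Qed.

Lemma tends_sum (F : nat -> nat -> K) (f : nat -> K) N :
  (forall m, tends (F^~ m) (f m)) ->
  tends (fun n => \sum_(m < N) F n m) (\sum_(m < N) f m).
Proof.
move=> Ff; elim: N => [|N IH].
  by rewrite big_ord0; apply: (tends_ext (tends_cst _)) => n; rewrite big_ord0.
rewrite big_ord_recr /=; apply: (tends_ext (tendsD IH (Ff N))) => n.
by rewrite big_ord_recr.
Qed.

Lemma tends_shift u a k : tends (fun n => u (n + k)%N) a <-> tends u a.
Proof.
split => /tendsP ua; apply/tendsP => e e0; have [N HN] := ua e e0.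
  exists (N + k)%N => n Nn; rewrite -(subnK (leq_trans (leq_addl N k) Nn)).
  by apply: HN; rewrite leq_subRL ?(leq_trans (leq_addl N k) Nn) // addnC.
by exists N => n Nn; apply: HN; exact: leq_trans (leq_addr _ _).
Qed.

End tends.

(** * Sums of series, dominated convergence and Cauchy products *)

Definition hassum (K : numFieldType) (f : nat -> K) (s : K) : Prop :=
  tends (fun n => \sum_(m < n) f m) s.

Section hassum.
Variable K : numFieldType.
Implicit Types (f g D : nat -> K) (s : K).

Lemma hassum_unique f s s' : hassum f s -> hassum f s' -> s = s'.
Proof. exact: tends_unique. Qed.

Lemma hassum_ext f g s : hassum f s -> (forall n, f n = g n) -> hassum g s.
Proof. by move=> fs fg; rewrite (_ : g = f) //; apply/funext => n; rewrite fg. Qed.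

Lemma hassumZ f s c : hassum f s -> hassum (fun n => c * f n) (c * s).
Proof.
by move=> fs; apply: (tends_ext (tendsMl c fs)) => n; rewrite mulr_sumr.
Qed.

Lemma hassumD f g s s' :
  hassum f s -> hassum g s' -> hassum (fun n => f n + g n) (s + s').
Proof.
by move=> fs gs; apply: (tends_ext (tendsD fs gs)) => n; rewrite big_split.
Qed.

Lemma hassumS f s : hassum (fun n => f n.+1) s <-> hassum f (f 0%N + s).
Proof.
split=> H.
  apply/(tends_shift _ _ 1); apply: (tends_ext (tendsD (tends_cst (f 0%N)) H)) => n.
  by rewrite addn1 big_ord_recl.
have {}H := (tends_shift _ _ 1).2 H.
have := tendsB H (tends_cst (f 0%N)); rewrite addrAC subrr add0r => {}H.
by apply: (tends_ext H) => n; rewrite addn1 big_ord_recl addrAC subrr add0r.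
Qed.

Lemma hassum_tail D s e : hassum D s -> 0 < e ->
  exists M, forall n m, (M <= n)%N -> (n <= m)%N ->
    `|\sum_(n <= k < m) D k| < e.
Proof.
move=> /tendsP Ds e0; have e20 : 0 < e / 2 by rewrite divr_gt0.
have [M HM] := Ds _ e20; exists M => n m Mn nm.
have -> : \sum_(n <= k < m) D k =
    (\sum_(k < m) D k - s) - (\sum_(k < n) D k - s).
  rewrite opprB addrA subrK -!(big_mkord xpredT).
  by rewrite (big_cat_nat (m := 0) (n := n) (p := m)) //= addrAC subrr add0r.
rewrite [e]splitr; apply: le_lt_trans (ler_normB _ _) _.
by apply: ltrD; apply: HM => //; exact: leq_trans nm.
Qed.

(** Beyond some column [M] the dominating tail makes every row negligible, uniformly in [n]; on the
    finitely many remaining columns the limit is taken termwise. *)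
Lemma tannery (F : nat -> nat -> K) f D (S : nat -> K) s d :
  (forall n m, `|F n m| <= D m) -> hassum D d ->
  (forall m, tends (F^~ m) (f m)) ->
  (forall n, hassum (F n) (S n)) -> hassum f s -> tends S s.
Proof.
move=> FD Dd Ff FS fs; apply/tendsP => e e0.
(* Error budget: two parts for cutting row [n] at [M], and one each for the block from [M] to [N'],
   the limit of finitely many columns and the tail of [f]. *)
have e50 : 0 < e / 5 by rewrite divr_gt0.
have [M HM] := hassum_tail Dd e50.
have tailF n m : (M <= m)%N -> `|\sum_(M <= k < m) F n k| < e / 5.
  move=> Mm; apply: le_lt_trans (HM M m (leqnn M) Mm).
  apply: (le_trans (ler_norm_sum _ _ _)).
  rewrite (ger0_norm (sumr_ge0 _ _)); last first.
    by move=> k _; exact: le_trans (FD 0%N k).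
  by apply: ler_sum => k _; exact: FD.
have Sclose n : `|S n - \sum_(m < M) F n m| < 2 * (e / 5).
  have /tendsP/(_ _ e50)[N HN] := FS n.
  have := HN _ (leq_maxl N M); have MN := leq_maxr N M.
  set N' := maxn N M in MN * => H.
  have -> : S n - \sum_(m < M) F n m =
      \sum_(M <= k < N') F n k - (\sum_(m < N') F n m - S n).
    rewrite -!(big_mkord xpredT) (big_cat_nat (m := 0) (n := M) (p := N')) //=.
    ring.
  rewrite mulr2n mulrDl !mul1r; apply: le_lt_trans (ler_normB _ _) _.
  by apply: ltrD => //; exact: tailF.
have tailf : exists N, forall n, (N <= n)%N ->
    `|S n - s| < e.
  have /tendsP/(_ _ e50)[N1 HN1] := tends_sum M Ff.
  have /tendsP/(_ _ e50)[N2 HN2] := fs.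
  have MN := leq_maxr N2 M; have := HN2 _ (leq_maxl N2 M).
  set N' := maxn N2 M in MN * => H2.
  have /tendsP/(_ _ e50)[N3 HN3] := tends_sum N' Ff.
  exists (maxn N1 N3) => n; rewrite geq_max => /andP[n1 n3].
  have -> : S n - s = (S n - \sum_(m < M) F n m) - (\sum_(M <= m < N') F n m)
     + (\sum_(m < N') F n m - \sum_(m < N') f m) + (\sum_(m < N') f m - s).
    rewrite -!(big_mkord xpredT (F n)) (big_cat_nat (m := 0) (n := M) (p := N')) //=.
    ring.
  have -> : e = 2 * (e / 5) + e / 5 + e / 5 + e / 5.
    by field.
  apply: le_lt_trans (ler_normD _ _) _; apply: ltrD => //.
  apply: le_lt_trans (ler_normD _ _) _; apply: ltrD; last exact: HN3.
  apply: le_lt_trans (ler_normB _ _) _; apply: ltrD => //; exact: tailF.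
exact: tailf.
Qed.

(** Grouped by the index of [f], the partial sums of the Cauchy product are rows whose entries are
    [f m] times a partial sum of [g]. The bound [C] makes [D m * C] a dominating series for
    Tannery's theorem. *)
Lemma mertens f g D d s s' C :
  (forall m, `|f m| <= D m) -> hassum D d ->
  (forall n, `|\sum_(k < n) g k| <= C) -> hassum f s -> hassum g s' ->
  hassum (fun n => \sum_(k < n.+1) f k * g (n - k)%N) (s * s').
Proof.
move=> fD Dd gC fs gs.
pose F n m := if (m < n)%N then f m * \sum_(k < n - m) g k else 0.
have C0 : 0 <= C by apply: le_trans (gC 0%N).
apply: (@tannery F (fun m => f m * s') (fun m => D m * C) _ _ (d * C)).
- move=> n m; rewrite /F; case: ifP => _; last first.
    by rewrite normr0 mulr_ge0 // (le_trans _ (fD m)).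
  by rewrite normrM ler_pM.
- by rewrite mulrC; apply: (hassum_ext (hassumZ C Dd)) => n; rewrite mulrC.
- move=> m; apply: (@tends_near _ (fun n => f m * \sum_(k < n - m) g k) _ _ m.+1).
    by move=> n mn; rewrite /F mn.
  apply: tendsMl; apply/(tends_shift _ _ m).
  by apply: (tends_ext gs) => n; rewrite addnK.
(* Row [n] vanishes from column [n] on, and its finite sum is matched with the Cauchy product by
   induction on [n]. *)
- move=> n; apply: (@tends_near _ (fun=> \sum_(m < n) F n m) _ _ n); last first.
    suff <- : \sum_(m < n) F n m = \sum_(m < n) \sum_(k < m.+1) f k * g (m - k)%N.
      exact: tends_cst.
    elim: n => [|n IH]; first by rewrite !big_ord0.
    rewrite [RHS]big_ord_recr /= -IH big_ord_recr /= [in RHS]big_ord_recr /=.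
    rewrite addrA -big_split /=; congr (_ + _).
      apply: eq_bigr => i _; rewrite /F ltn_ord (leq_trans (ltn_ord i)) //.
      by rewrite subSn 1?ltnW // big_ord_recr /= mulrDr.
    by rewrite /F ltnSn subSnn subnn big_ord1.
  move=> N nN; rewrite -!(big_mkord xpredT) [RHS](big_cat_nat (n := n)) //=.
  rewrite [X in _ = _ + X]big_nat_cond [X in _ = _ + X]big1 ?addr0 //.
  by move=> i /andP[/andP[ni _] _]; rewrite /F ltnNge ni.
- by rewrite mulrC; apply: (hassum_ext (hassumZ s' fs)) => n; rewrite mulrC.
Qed.

Lemma hassum_bounded f s : hassum f s -> exists C, forall n, `|f n| <= C.
Proof.
move=> fs; have [M HM] := hassum_tail fs (ltr01 (R := K)).
exists (1 + \sum_(k < M) `|f k|) => n; case: (ltnP n M) => nM.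
  rewrite (bigD1 (Ordinal nM)) //= addrCA lerDl addr_ge0 //.
  by rewrite sumr_ge0.
have := HM n n.+1 nM (leqnSn n); rewrite big_nat1 => /ltW H.
by apply: le_trans H _; rewrite lerDl sumr_ge0.
Qed.

Lemma hassum_partial_bounded f s :
  hassum f s -> exists C, forall n, `|\sum_(k < n) f k| <= C.
Proof.
move=> fs; have [M HM] := hassum_tail fs (ltr01 (R := K)).
exists (1 + \sum_(k < M) `|f k|) => n; case: (ltnP n M) => nM.
  apply: le_trans (ler_norm_sum _ _ _) _.
  rewrite -!(big_mkord xpredT (fun k => `|f k|)).
  rewrite [X in _ <= _ + X](big_cat_nat (n := n)) ?(ltnW nM) //=.
  by rewrite addrCA lerDl addr_ge0 // sumr_ge0.
have := HM M n (leqnn M) nM => /ltW H.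
rewrite -(big_mkord xpredT) (big_cat_nat (n := M)) //= addrC.
apply: le_trans (ler_normD _ _) _; apply: lerD => //.
by rewrite big_mkord; apply: ler_norm_sum.
Qed.

End hassum.

(** * Uniqueness of power series coefficients *)

Lemma power_series_coef0 (K : numFieldType) (c : nat -> K) (u : nat -> K)
    (rho d : K) :
  tends u 0 -> (forall n, u n != 0) -> (forall n, `|u n| <= rho) ->
  hassum (fun t => `|c t| * rho ^+ t) d ->
  (forall n, hassum (fun t => c t * u n ^+ t) 0) -> c 0%N = 0.
Proof.
move=> u0 un0 urho cd cu.
have rho0 : 0 < rho by apply: lt_le_trans (urho 0%N); rewrite normr_gt0.
apply/esym/(tends_unique (tends_cst 0)).
(* As the points [u n] tend to 0, every term of positive degree tends to 0, so the limit of the sums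
   is the constant coefficient. *)
apply: (@tannery K (fun n m => c m * u n ^+ m)
          (fun m => if m == 0%N then c 0%N else 0) _ _ _ d _ cd _ cu).
- by move=> n m; rewrite normrM normrX ler_wpM2l // lerXn2r // nnegrE ltW.
- case=> [|m]; first by apply: (tends_ext (tends_cst _)) => n; rewrite expr0 mulr1.
  rewrite /= -(mulr0 (c m.+1)); apply: tendsMl.
  elim: m => [|m IH]; first by apply: (tends_ext u0) => n; rewrite expr1.
  rewrite -(mul0r 0); apply: (tends_ext (tendsM u0 IH)) => n.
  by rewrite -exprS.
- apply/(tends_shift _ _ 1); apply: (tends_ext (tends_cst _)) => n.
  by rewrite addn1 big_ord_recl big1 ?addr0.
Qed.

(** Once the constant coefficient vanishes, division by [u n] leaves the shifted series, which
    vanishes at the same points and is dominated at the same radius. *)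
Lemma power_series_eq0 (K : numFieldType) (c : nat -> K) (u : nat -> K)
    (rho d : K) :
  tends u 0 -> (forall n, u n != 0) -> (forall n, `|u n| <= rho) ->
  hassum (fun t => `|c t| * rho ^+ t) d ->
  (forall n, hassum (fun t => c t * u n ^+ t) 0) ->
  forall t, c t = 0.
Proof.
move=> u0 un0 urho cd cu t.
have rho0 : 0 < rho by apply: lt_le_trans (urho 0%N); rewrite normr_gt0.
elim: t c d cd cu => [|t IH] c d cd cu.
  exact: power_series_coef0 cd cu.
have c0 : c 0%N = 0 by exact: power_series_coef0 cd cu.
apply: (IH (fun t => c t.+1) (rho^-1 * d)).
  have : hassum (fun t => `|c t.+1| * rho ^+ t.+1) d.
    by apply/(hassumS (fun t => `|c t| * rho ^+ t)); rewrite c0 normr0 mul0r add0r.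
  move=> /(hassumZ rho^-1) H; apply: (hassum_ext H) => n.
  by rewrite exprS; field; rewrite gt_eqF.
move=> n; have : hassum (fun t => c t.+1 * u n ^+ t.+1) 0.
  by apply/(hassumS (fun t => c t * u n ^+ t)); rewrite c0 mul0r add0r.
move=> /(hassumZ (u n)^-1); rewrite mulr0 => H; apply: (hassum_ext H) => m.
by rewrite exprS; field.
Qed.

(** * Complex powers *)

Local Open Scope complex_scope.

Section cpow.
Variable R : realType.
Implicit Types (x y a b r : R) (z w : R[i]).

Definition cis x : R[i] := cos x +i* sin x.

(** The norm of [R[i]] takes values in [R[i]]; this is its value in [R], in the form in which it
    occurs in [carg] and [cpow]. *)
Definition modulus z : R := complex.Re `|z|.

Lemma modulusE z : `|z| = (modulus z)%:C.
Proof. by rewrite /modulus normc_def. Qed.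

Lemma modulus_ge0 z : 0 <= modulus z.
Proof. by rewrite -lecR -modulusE normr_ge0. Qed.

Lemma modulus_gt0 z : (0 < modulus z) = (z != 0).
Proof. by rewrite -ltcR -modulusE normr_gt0. Qed.

Lemma modulusM z w : modulus (z * w) = modulus z * modulus w.
Proof. by apply: complexI; rewrite -modulusE normrM !modulusE rmorphM. Qed.

Lemma modulusN z : modulus (- z) = modulus z.
Proof. by rewrite /modulus normrN. Qed.

Lemma modulusR x : modulus x%:C = `|x|.
Proof. by rewrite /modulus normc_def /= expr0n /= addr0 sqrtr_sqr. Qed.

Lemma sqr_modulus z : modulus z ^+ 2 = complex.Re z ^+ 2 + complex.Im z ^+ 2.
Proof.
by rewrite /modulus normc_def /= sqr_sqrtr // addr_ge0 // sqr_ge0.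
Qed.

Lemma cisD x y : cis (x + y) = cis x * cis y.
Proof.
by rewrite /cis cosD sinD; apply/eqP; rewrite eq_complex /= eqxx /= addrC.
Qed.

Lemma modulus_cis x : modulus (cis x) = 1.
Proof. by rewrite /modulus normc_def /= cos2Dsin2 sqrtr1. Qed.

Lemma Re_div_modulus z : z != 0 -> -1 <= complex.Re z / modulus z <= 1.
Proof.
rewrite -modulus_gt0 => z0; rewrite ler_pdivlMr // ler_pdivrMr // mulN1r mul1r.
rewrite -ler_norml -(ler_pXn2r (ltn0Sn 1)) ?nnegrE ?modulus_ge0 //.
by rewrite -normrX (ger0_norm (sqr_ge0 _)) sqr_modulus lerDl sqr_ge0.
Qed.

Lemma polar z : z = (modulus z)%:C * cis (carg z).
Proof.
have [->|z0] := eqVneq z 0; first by rewrite modulusR normr0 mul0r.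
have m0 : modulus z != 0 by rewrite gt_eqF // modulus_gt0.
have H := Re_div_modulus z0.
have Hcos : cos (carg z) = complex.Re z / modulus z.
  by rewrite /carg; case: ifP => _; rewrite ?cosN acosK // in_itv.
have Hsin : sin (carg z) = complex.Im z / modulus z.
  (* The arccosine fixes the sine only up to sign; the test on the imaginary part in [carg] restores
     the sign. *)
  have E : Num.sqrt (1 - (complex.Re z / modulus z) ^+ 2) =
      `|complex.Im z| / modulus z.
    have -> : 1 - (complex.Re z / modulus z) ^+ 2 =
        (complex.Im z / modulus z) ^+ 2.
      have m2 : modulus z ^+ 2 != 0 by rewrite expf_neq0.
      rewrite !expr_div_n -{1}(divff m2) -mulrBl {1}sqr_modulus.
      by rewrite addrAC subrr add0r.
    rewrite sqrtr_sqr normrM normfV.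
    by rewrite (ger0_norm (modulus_ge0 z)).
  rewrite /carg -/(modulus z); case: ifPn => Im0.
    by rewrite sin_acos // E ger0_norm.
  by rewrite sinN sin_acos // E ltr0_norm ?ltNge // mulNr opprK.
rewrite /cis Hcos Hsin; apply/eqP; rewrite eq_complex /=.
by rewrite !mul0r subr0 addr0 ![modulus z * _]mulrC !divfK ?eqxx.
Qed.

Lemma carg_polar r x : 0 < r -> - pi < x <= pi -> carg (r%:C * cis x) = x.
Proof.
move=> r0 /andP[x1 x2].
have m : modulus (r%:C * cis x) = r.
  by rewrite modulusM modulusR modulus_cis mulr1 gtr0_norm.
rewrite /carg -/(modulus _) m /= !mul0r subr0 addr0.
have -> : r * cos x / r = cos x by field; rewrite gt_eqF.
rewrite pmulr_rge0 //; case: (leP 0 x) => x0.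
  have -> : 0 <= sin x by apply: sin_ge0_pi; rewrite x0.
  by rewrite cosK // in_itv /= x0.
(* For [- pi < x < 0] the sine is negative, so [carg] takes the branch [- th], and the arccosine of
   [cos x] is [- x]. *)
have -> : (0 <= sin x) = false.
  apply/negbTE; rewrite -ltNge -oppr_gt0 -sinN; apply: sin_gt0_pi.
  by rewrite oppr_gt0 x0 /=; lra.
by rewrite cosKN ?opprK //; lra.
Qed.

Lemma cpow_polar r x a : 0 < r -> - pi < x <= pi ->
  cpow (r%:C * cis x) a = (r `^ a)%:C * cis (a * x).
Proof.
move=> r0 hx; rewrite /cpow -/(modulus _) carg_polar //.
by rewrite modulusM modulusR modulus_cis mulr1 gtr0_norm.
Qed.

Lemma cpowE z a : cpow z a = (modulus z `^ a)%:C * cis (a * carg z).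
Proof. by []. Qed.

Lemma modulus_cpow z a : modulus (cpow z a) = modulus z `^ a.
Proof. by rewrite cpowE modulusM modulusR modulus_cis mulr1 ger0_norm ?powR_ge0. Qed.

Lemma cpow_real x a : 0 < x -> cpow x%:C a = (x `^ a)%:C.
Proof.
move=> x0; have := @cpow_polar x 0 a x0; rewrite mulr0 /cis cos0 sin0.
by rewrite !mulr1 => -> //; have := pi_gt0 R; lra.
Qed.

Lemma cpowD z a b : z != 0 -> cpow z (a + b) = cpow z a * cpow z b.
Proof.
move=> z0; rewrite !cpowE mulrDl cisD powRD ?rmorphM /=; first by ring.
by apply/implyP => _; rewrite gt_eqF // modulus_gt0.
Qed.

Lemma cpow0 z : cpow z 0 = 1.
Proof. by rewrite cpowE powRr0 mul0r /cis cos0 sin0 mulr1. Qed.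

Lemma cpow1 z : cpow z 1 = z.
Proof. by rewrite cpowE powRr1 ?modulus_ge0 // mul1r -polar. Qed.

Lemma cpow_eq0 z a : z != 0 -> cpow z a != 0.
Proof. by rewrite -!modulus_gt0 modulus_cpow; exact: powR_gt0. Qed.

Lemma cpowN z a : z != 0 -> cpow z (- a) = (cpow z a)^-1.
Proof.
move=> z0; apply: (mulIf (cpow_eq0 a z0)).
by rewrite -cpowD // addNr cpow0 mulVf // cpow_eq0.
Qed.

Lemma cpow_nat z a n : z != 0 -> cpow z (a * n%:R) = cpow z a ^+ n.
Proof.
move=> z0; elim: n => [|n IH]; first by rewrite mulr0 cpow0 expr0.
by rewrite -natr1 mulrDr mulr1 cpowD // IH exprSr.
Qed.

Lemma Re_gt0_neq0 z : 0 < complex.Re z -> z != 0.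
Proof. by move=> H; apply/eqP => E; rewrite E /= ltxx in H. Qed.

Lemma Re_gt0_carg z : 0 < complex.Re z -> - (pi / 2) < carg z < pi / 2.
Proof.
move=> Rez; have z0 := Re_gt0_neq0 Rez.
have H := Re_div_modulus z0; have [a0 api] := (acos_ge0 H, acos_lepi H).
have pi0 := pi_gt0 R.
suff : acos (complex.Re z / modulus z) < pi / 2.
  by rewrite /carg -/(modulus z); case: ifP; lra.
rewrite ltNge; apply/negP => H2.
(* An arccosine of at least pi/2, lowered by pi, lies in [-pi/2, 0] and has nonnegative cosine; but
   that cosine is the opposite of a positive quotient. *)
have : 0 <= cos (acos (complex.Re z / modulus z) - pi / 2 - pi/2).
  by apply: cos_ge0_pihalf; lra.
rewrite cosB cosB sinB cos_pihalf sin_pihalf acosK ?in_itv //.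
have : 0 < complex.Re z / modulus z by rewrite divr_gt0 // modulus_gt0.
lra.
Qed.

(** Both arguments lie strictly between -pi/2 and pi/2, so their sum is the principal argument of
    the product. *)
Lemma cpowM z w a : 0 < complex.Re z -> 0 < complex.Re w ->
  cpow (z * w) a = cpow z a * cpow w a.
Proof.
move=> Rez Rew.
have [z0 w0] := (Re_gt0_neq0 Rez, Re_gt0_neq0 Rew).
have [hz hw] := (Re_gt0_carg Rez, Re_gt0_carg Rew).
have -> : z * w = (modulus z * modulus w)%:C * cis (carg z + carg w).
  by rewrite {1}(polar z) {1}(polar w) cisD rmorphM /=; ring.
rewrite cpow_polar ?mulr_gt0 ?modulus_gt0 //; last by lra.
by rewrite !cpowE powRM ?modulus_ge0 // mulrDr cisD rmorphM /=; ring.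
Qed.

(** The bounds on [a] keep [a * carg z] in the principal range. *)
Lemma cpow_cpow z a b : 0 < complex.Re z -> 0 <= a <= 1 ->
  cpow (cpow z a) b = cpow z (a * b).
Proof.
move=> Rez ha; have z0 := Re_gt0_neq0 Rez; have hz := Re_gt0_carg Rez.
rewrite (cpowE z a); have := pi_gt0 R.
rewrite cpow_polar ?powR_gt0 ?modulus_gt0 //; last by nra.
by rewrite cpowE powRrM mulrCA mulrA.
Qed.

Lemma Re_cpow_gt0 z a : 0 < complex.Re z -> -1 <= a <= 1 ->
  0 < complex.Re (cpow z a).
Proof.
move=> Rez ha; have z0 := Re_gt0_neq0 Rez; have hz := Re_gt0_carg Rez.
rewrite cpowE /= mul0r subr0 mulr_gt0 ?powR_gt0 ?modulus_gt0 //.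
apply: cos_gt0_pihalf; rewrite -ltr_norml normrM.
rewrite -ltr_norml in hz; apply: le_lt_trans hz.
by rewrite ler_piMl // ler_norml.
Qed.

End cpow.

(** * The binomial series *)

Section bincoef.
Variable R : realType.
Implicit Types (x y : R) (n m k : nat).

(** The coefficient of z^m in (1 - z)^(-x). *)
Definition bincoef x m : R := poch x m / m`!%:R.

Lemma pochS x m : poch x m.+1 = poch x m * (x + m%:R).
Proof. by rewrite /poch big_ord_recr. Qed.

Lemma pochSl x m : poch x m.+1 = x * poch (x + 1) m.
Proof.
rewrite /poch big_ord_recl addr0; congr (_ * _); apply: eq_bigr => i _.
by rewrite /= /bump /= natrD addrA.
Qed.

Lemma bincoef0 x : bincoef x 0 = 1.
Proof. by rewrite /bincoef /poch big_ord0 fact0 divr1. Qed.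

Lemma factS_neq0 m : (m.+1)%:R * m`!%:R != 0 :> R.
Proof. by rewrite -natrM pnatr_eq0 -factS -lt0n fact_gt0. Qed.

Lemma bincoefS x m : m.+1%:R * bincoef x m.+1 = (x + m%:R) * bincoef x m.
Proof.
have := factS_neq0 m; rewrite mulf_eq0 negb_or => /andP[H1 H2].
rewrite /bincoef pochS factS natrM.
by move: (m.+1%:R) (m`!%:R) H1 H2 => a b H1 H2; field; rewrite H1 H2.
Qed.

Lemma bincoefSl x m : m.+1%:R * bincoef x m.+1 = x * bincoef (x + 1) m.
Proof.
have := factS_neq0 m; rewrite mulf_eq0 negb_or => /andP[H1 H2].
rewrite /bincoef pochSl factS natrM.
by move: (m.+1%:R) (m`!%:R) H1 H2 => a b H1 H2; field; rewrite H1 H2.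
Qed.

(** Coefficient form of (1 - z) (1 - z)^(-x-1) = (1 - z)^(-x). *)
Lemma bincoef_pascal x m :
  bincoef (x + 1) m.+1 = bincoef (x + 1) m + bincoef x m.+1.
Proof.
have H : m.+1%:R != 0 :> R by rewrite pnatr_eq0.
apply: (mulfI H); rewrite mulrDr bincoefS bincoefSl -natr1; ring.
Qed.

Lemma bincoef_ge0 x m : 0 <= x -> 0 <= bincoef x m.
Proof.
move=> x0; rewrite divr_ge0 //; apply: prodr_ge0 => i _.
by rewrite addr_ge0.
Qed.

Lemma bincoef_le x y m : 0 <= x <= y -> bincoef x m <= bincoef y m.
Proof.
move=> /andP[x0 xy]; rewrite ler_wpM2r ?invr_ge0 //; apply: ler_prod => i _.
by rewrite addr_ge0 //= lerD2r.
Qed.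

Lemma bincoef_norm x m : `|bincoef x m| <= bincoef `|x| m.
Proof.
rewrite normrM normfV normr_nat ler_wpM2r ?invr_ge0 // normr_prod.
apply: ler_prod => i _; rewrite normr_ge0 /=.
by apply: le_trans (ler_normD _ _) _; rewrite normr_nat.
Qed.

Lemma bincoef_0l m : bincoef 0 m = (m == 0%N)%:R.
Proof.
case: m => [|m]; first exact: bincoef0.
by rewrite /bincoef pochSl !mul0r.
Qed.

Lemma bincoef_1l m : bincoef 1 m = 1.
Proof.
elim: m => [|m IH]; first exact: bincoef0.
by have := bincoef_pascal 0 m; rewrite add0r IH bincoef_0l addr0.
Qed.

(** Induction after multiplying by n + 1 and splitting this factor as k + (n + 1 - k). By [bincoefS]
    the two halves carry the weights x + k and y + n - k, which add up to x + y + n. *)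
Lemma bincoefD x y n :
  bincoef (x + y) n = \sum_(k < n.+1) bincoef x k * bincoef y (n - k)%N.
Proof.
elim: n => [|n IH]; first by rewrite big_ord1 !bincoef0 mulr1.
have H : n.+1%:R != 0 :> R by rewrite pnatr_eq0.
apply: (mulfI H); rewrite bincoefS {}IH.
have -> : n.+1%:R * (\sum_(k < n.+2) bincoef x k * bincoef y (n.+1 - k)) =
   \sum_(k < n.+2) k%:R * bincoef x k * bincoef y (n.+1 - k)%N +
   \sum_(k < n.+2) (n.+1 - k)%:R * bincoef x k * bincoef y (n.+1 - k)%N.
  rewrite mulr_sumr -big_split; apply: eq_bigr => i _ /=.
  rewrite -!mulrDl -natrD subnKC -?mulrA //; exact: (ltn_ord i).
rewrite [X in _ = X + _]big_ord_recl /= !mul0r add0r.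
rewrite [X in _ = _ + X]big_ord_recr /= subnn !mul0r addr0.
rewrite -big_split mulr_sumr; apply: eq_bigr => i _ /=.
have ii : (i <= n)%N by rewrite -ltnS.
rewrite /bump /= add1n bincoefS subSS subSn // -[X in _ = _ + X]mulrA.
rewrite [X in _ = _ + X]mulrCA bincoefS natrB //; ring.
Qed.

End bincoef.

(** * Convergence by domination; real and complex series *)

Section summability.
Variable R : realType.
Implicit Types (f D : nat -> R) (x rho s d C : R).

Lemma ex_hassum_ge0 f C : (forall n, 0 <= f n) ->
  (forall n, \sum_(k < n) f k <= C) -> exists s, hassum f s.
Proof.
move=> f0 fC; have : cvgn (fun n => \sum_(k < n) f k).
  apply: nondecreasing_is_cvgn; last by exists C => _ [n _ <-].
  apply/nondecreasing_seqP => n; rewrite big_ord_recr /= lerDl; exact: f0.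
by move=> H; exists (limn (fun n => \sum_(k < n) f k)); split.
Qed.

Lemma hassum_ge0_le f s n : (forall n, 0 <= f n) -> hassum f s ->
  \sum_(k < n) f k <= s.
Proof.
move=> f0 /tendsP fs; rewrite leNgt; apply/negP => sn.
have [N HN] := fs _ (etrans (subr_gt0 _ _) sn).
have := HN _ (leq_maxl N n).
have : \sum_(k < n) f k <= \sum_(k < maxn N n) f k.
  rewrite -!(big_mkord xpredT f) [leRHS](big_cat_nat (n := n)) ?leq_maxr //=.
  by rewrite lerDl sumr_ge0.
rewrite ltr_norml; lra.
Qed.

(** The series of [D + f] has nonnegative terms and bounded partial sums; the sum of [D] is then
    subtracted. *)
Lemma ex_hassum_dom f D d : (forall n, `|f n| <= D n) -> hassum D d ->
  exists s, hassum f s.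
Proof.
move=> fD Dd.
have [||s Hs] := @ex_hassum_ge0 (fun n => D n + f n) (d + d).
- by move=> n; have := fD n; rewrite ler_norml; lra.
- move=> n; rewrite big_split /=.
  have D0 k : 0 <= D k by apply: le_trans (fD k).
  apply: lerD; first exact: hassum_ge0_le.
  apply: le_trans (hassum_ge0_le n D0 Dd); apply: ler_sum => i _.
  by apply: le_trans (fD i); exact: ler_norm.
exists (s - d); have := hassumD Hs (hassumZ (-1) Dd); rewrite mulN1r => H.
by apply: (hassum_ext H) => n; ring.
Qed.

Lemma tends_RC (u : nat -> R) (l : R) : tends u l ->
  tends (fun n => (u n)%:C) l%:C.
Proof.
move=> /tendsP ul; apply/tendsP => e e0.
have eR : e = (complex.Re e)%:C by rewrite RRe_real // gtr0_real.
rewrite eR; rewrite eR ltcR in e0.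
have [N HN] := ul _ e0; exists N => n Nn.
by rewrite -rmorphB modulusE modulusR ltcR; exact: HN.
Qed.

Lemma tends_Re (u : nat -> R[i]) (l : R[i]) : tends u l ->
  tends (fun n => complex.Re (u n)) (complex.Re l).
Proof.
move=> /tendsP ul; apply/tendsP => e; rewrite -ltcR => e0.
have [N HN] := ul _ e0; exists N => n Nn; rewrite -ltcR.
apply: le_lt_trans (HN n Nn); have := normc_ge_Re (u n - l).
by case: (u n) => ? ?; case: (l).
Qed.

Lemma hassum_RC f s : hassum f s -> hassum (fun n => (f n)%:C) s%:C.
Proof.
by move=> /tends_RC H; apply: (tends_ext H) => n; rewrite rmorph_sum.
Qed.

Lemma hassum_Re (f : nat -> R[i]) (s : R[i]) : hassum f s ->
  hassum (fun n => complex.Re (f n)) (complex.Re s).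
Proof.
move=> /tends_Re H; apply: (tends_ext H) => n.
elim: n => [|n IH]; first by rewrite !big_ord0.
by rewrite !big_ord_recr /= -IH; case: (\sum_(k < n) _) (f n) => ? ? [].
Qed.

Lemma normc_ge_Im (z : R[i]) : `|complex.Im z|%:C <= `|z|.
Proof.
rewrite modulusE lecR -(ler_pXn2r (ltn0Sn 1)) ?nnegrE ?modulus_ge0 //.
by rewrite sqr_modulus -normrX (ger0_norm (sqr_ge0 _)) lerDr sqr_ge0.
Qed.

Lemma ex_hassum_domC (f : nat -> R[i]) D d :
  (forall n, `|f n| <= (D n)%:C) -> hassum D d -> exists s : R[i], hassum f s.
Proof.
move=> fD Dd.
have [|sr Hr] := @ex_hassum_dom (fun n => complex.Re (f n)) D d _ Dd.
  by move=> n; rewrite -lecR; exact: le_trans (normc_ge_Re _) (fD n).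
have [|si Hi] := @ex_hassum_dom (fun n => complex.Im (f n)) D d _ Dd.
  by move=> n; rewrite -lecR; exact: le_trans (normc_ge_Im _) (fD n).
exists (sr%:C + 'i * si%:C).
have := hassumD (hassum_RC Hr) (hassumZ 'i (hassum_RC Hi)) => H.
by apply: (hassum_ext H) => n; rewrite [RHS]complexE.
Qed.

End summability.

Lemma tends_norm_le (K : numFieldType) (u : nat -> K) (l a C : K) :
  tends u l -> (forall n, `|u n - a| <= C) -> `|l - a| <= C.
Proof.
move=> /tendsP ul uC; have C0 : 0 <= C by apply: le_trans (uC 0%N).
rewrite real_leNgt ?normr_real ?ger0_real //; apply/negP => lC.
have [N HN] := ul _ (etrans (subr_gt0 _ _) lC).
have := HN N (leqnn N); apply/negP; rewrite -real_leNgt ?realB ?normr_real ?ger0_real //.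
rewrite lerBlDr; apply: le_trans (lerD (lexx _) (uC N)).
rewrite (distrC (u N)); apply: le_trans (ler_normD _ _).
by rewrite addrA subrK.
Qed.

Section binomial_series.
Variable R : realType.
Implicit Types (x y rho : R) (z : R[i]).

Lemma hassum_geometric rho : 0 <= rho < 1 ->
  hassum (fun n => rho ^+ n) (1 - rho)^-1.
Proof.
move=> /andP[r0 r1]; split.
have := @cvg_geometric_series R 1 rho; rewrite ger0_norm // => /(_ r1).
rewrite mul1r (_ : series _ = fun n => \sum_(m < n) rho ^+ m) //.
apply/funext => n; rewrite /series /= big_mkord; apply: eq_bigr => i _.
by rewrite /geometric /= mul1r.
Qed.

(** Induction on [N]: multiplied by [1 - rho], the truncated sum for N + 1 becomes the one for N
    minus a nonnegative boundary term. *)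
Lemma bincoef_nat_bound N rho n : 0 <= rho < 1 ->
  \sum_(k < n) bincoef (N%:R : R) k * rho ^+ k <= (1 - rho) ^- N.
Proof.
move=> /andP[r0 r1]; elim: N n => [|N IH] n.
  rewrite expr0 invr1; case: n => [|n]; first by rewrite big_ord0.
  rewrite big_ord_recl big1 ?addr0; last first.
    by move=> i _; rewrite bincoef_0l mul0r.
  by rewrite bincoef0 mulr1.
have r1' : 0 < 1 - rho by rewrite subr_gt0.
rewrite exprSr invfM mulrC ler_pdivlMl //.
apply: le_trans (IH n); case: n => [|n]; first by rewrite !big_ord0 mulr0.
(* Summation by parts. *)
have -> : \sum_(k < n.+1) bincoef (N%:R : R) k * rho ^+ k =
    (1 - rho) * \sum_(k < n.+1) bincoef (N.+1%:R : R) k * rho ^+ k +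
    bincoef (N.+1%:R) n * rho ^+ n.+1.
  elim: n => [|n IHn]; first by rewrite !big_ord1 !bincoef0 !expr0 expr1; ring.
  rewrite big_ord_recr /= IHn [in RHS]big_ord_recr /= -natr1 bincoef_pascal.
  by rewrite !exprS; ring.
by rewrite lerDl mulr_ge0 ?exprn_ge0 ?bincoef_ge0.
Qed.

Lemma ex_hassum_bincoef x rho : 0 <= rho < 1 ->
  exists d, hassum (fun t => `|bincoef x t| * rho ^+ t) d.
Proof.
move=> hr; have /andP[r0 r1] := hr.
(* A natural number above [|x|], so that the coefficients for [N] dominate those for [x]. *)
pose N := (Num.truncn `|x|).+1.
apply: (@ex_hassum_ge0 _ _ ((1 - rho) ^- N)).
  by move=> n; rewrite mulr_ge0 ?exprn_ge0.
move=> n; apply: le_trans (bincoef_nat_bound N n hr).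
apply: ler_sum => i _; rewrite ler_wpM2r ?exprn_ge0 //.
apply: le_trans (bincoef_norm _ _) _; apply: bincoef_le.
by rewrite normr_ge0 /= ltW // truncnS_gt.
Qed.

Lemma norm_bincoef_expr x z t :
  `|(bincoef x t)%:C * z ^+ t| = (`|bincoef x t| * modulus z ^+ t)%:C.
Proof. by rewrite normrM normrX !modulusE modulusR rmorphM rmorphXn. Qed.

(** Choice turns the sums into a function of the exponent, for which a functional equation can be
    stated. *)
Lemma ex_binomial_sum z : modulus z < 1 ->
  exists B : R -> R[i],
    forall x, hassum (fun t => (bincoef x t)%:C * z ^+ t) (B x).
Proof.
move=> z1.
have [|B HB] := @choice R R[i]
  (fun x => hassum (fun t => (bincoef x t)%:C * z ^+ t)); last by exists B.
move=> x; have [|d Hd] := @ex_hassum_bincoef x (modulus z) _.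
  by rewrite modulus_ge0.
by apply: ex_hassum_domC Hd => n; rewrite norm_bincoef_expr.
Qed.

Lemma bincoefN_diff x m :
  bincoef (- x) m.+1 = bincoef (1 - x) m.+1 - bincoef (1 - x) m.
Proof. by rewrite [1 - x]addrC bincoef_pascal addrAC subrr add0r. Qed.

(* For [0 <= x <= 1] the coefficients of [(1 - z) ^ x] after the first are
   nonpositive and telescope, so their absolute values add up to at most 1. *)
Lemma bincoefN_normE x m : 0 <= x <= 1 ->
  `|bincoef (- x) m.+1| = bincoef (1 - x) m - bincoef (1 - x) m.+1.
Proof.
move=> /andP[x0 x1]; rewrite ler0_norm; first by rewrite bincoefN_diff opprB.
rewrite -(pmulr_rle0 _ (ltr0Sn R m)) bincoefSl mulNr oppr_le0 mulr_ge0 //.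
by rewrite bincoef_ge0 // addrC subr_ge0.
Qed.

(** Multiplied by m + 1, the left side is x times the coefficient for 1 - x, which is at most the
    coefficient for 1, namely 1. *)
Lemma bincoefN_norm_le x m : 0 <= x <= 1 -> `|bincoef (- x) m.+1| <= x.
Proof.
move=> /andP[x0 x1].
have : `|m.+1%:R * bincoef (- x) m.+1| <= x.
  rewrite bincoefSl normrM normrN (ger0_norm x0) ler_piMr // addrC.
  rewrite ger0_norm ?bincoef_ge0 ?subr_ge0 //.
  apply: (@le_trans _ _ (bincoef 1 m)); last by rewrite bincoef_1l.
  by apply: bincoef_le; rewrite subr_ge0 x1 /= gerBl.
rewrite normrM normr_nat; apply: le_trans; rewrite ler_peMl //.
by rewrite ler1n.
Qed.

Lemma sum_bincoefN_le1 x n : 0 <= x <= 1 ->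
  \sum_(k < n) `|bincoef (- x) k.+1| <= 1.
Proof.
move=> hx; suff -> : \sum_(k < n) `|bincoef (- x) k.+1| = 1 - bincoef (1 - x) n.
  by rewrite gerBl bincoef_ge0 // subr_ge0; case/andP: hx.
elim: n => [|n IH]; first by rewrite big_ord0 bincoef0 subrr.
by rewrite big_ord_recr /= IH bincoefN_normE //; ring.
Qed.

Lemma tends_continuous (f : R -> R) (t : nat -> R) (a : R) :
  {for a, continuous f} -> tends t a -> tends (fun n => f (t n)) (f a).
Proof. by move=> fa [ta]; split; exact: (continuous_cvg _ fa ta). Qed.

Lemma tends_cpow0 (z : R[i]) (t : nat -> R) : z != 0 -> tends t 0 ->
  tends (fun n => cpow z (t n)) 1.
Proof.
move=> z0 t0; have m0 : modulus z != 0 by rewrite gt_eqF // modulus_gt0.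
have tc c : tends (fun n => t n * c) 0.
  by rewrite -(mul0r c); apply: tendsM => //; exact: tends_cst.
have H1 := tends_continuous (@continuous_expR R _) (tc (ln (modulus z))).
have H2 := tends_continuous (@continuous_cos R _) (tc (carg z)).
have H3 := tends_continuous (@continuous_sin R _) (tc (carg z)).
have := tendsM (tends_RC H1)
  (tendsD (tends_RC H2) (tendsMl 'i (tends_RC H3))).
rewrite expR0 cos0 sin0 mulr0 addr0 mulr1 => H; apply: (tends_ext H) => n.
by rewrite cpowE /powR (negbTE m0) [in RHS](complexE (cis _)).
Qed.

Lemma tends_squeeze (u : nat -> R[i]) (l : R[i]) (v : nat -> R) :
  (forall n, `|u n - l| <= (v n)%:C) -> tends v 0 -> tends u l.
Proof.
move=> uv /tends_RC/tendsP v0; apply/tendsP => e e0.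
have [N HN] := v0 e e0; exists N => n Nn.
apply: le_lt_trans (uv n) _; apply: le_lt_trans (HN n Nn); rewrite subr0.
by rewrite ger0_norm // (le_trans _ (uv n)).
Qed.

Lemma tends_half : tends (fun k => 2^-1 ^+ k : R) 0.
Proof. by split; apply: cvg_expr; rewrite ger0_norm; lra. Qed.

(** * The functional equation and the binomial theorem *)

Section sum.
Variables (z : R[i]) (B : R -> R[i]).
Hypothesis z1 : modulus z < 1.
Hypothesis BE : forall x, hassum (fun t => (bincoef x t)%:C * z ^+ t) (B x).

Let rho := modulus z.
Let rho01 : 0 <= rho < 1. Proof. by rewrite modulus_ge0. Qed.

Lemma binomial_sumD x y : B (x + y) = B x * B y.
Proof.
have [d Hd] := @ex_hassum_bincoef x rho rho01.
have [C HC] := hassum_partial_bounded (BE y).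
apply: (hassum_unique (BE (x + y))).
have fD m : `|(bincoef x m)%:C * z ^+ m| <= (`|bincoef x m| * rho ^+ m)%:C.
  by rewrite norm_bincoef_expr.
have H := mertens fD (hassum_RC Hd) HC (BE x) (BE y).
apply: (hassum_ext H) => n.
rewrite bincoefD rmorph_sum mulr_suml; apply: eq_bigr => i _.
rewrite (rmorphM _ (bincoef x i)) /=; have -> : z ^+ n = z ^+ i * z ^+ (n - i)%N.
  by rewrite -exprD subnKC // -ltnS.
by ring.
Qed.

Lemma binomial_sum0 : B 0 = 1.
Proof.
apply: (hassum_unique (BE 0)); apply/(tends_shift _ _ 1).
apply: (tends_ext (tends_cst _)) => n; rewrite addn1 big_ord_recl big1.
  by rewrite bincoef0 mulr1 addr0.
by move=> i _; rewrite bincoef_0l mul0r.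
Qed.

Lemma Re_onem_gt0 : 0 < complex.Re (1 - z).
Proof.
have := normc_ge_Re z; rewrite modulusE lecR => H.
have : `|complex.Re z| < 1 by apply: le_lt_trans H _.
by case: z => a b /=; rewrite ltr_norml; lra.
Qed.

(** All coefficients are 1, hence B(1) = 1 + z B(1). *)
Lemma binomial_sum1 : B 1 * (1 - z) = 1.
Proof.
have H1 := BE 1; have := hassumZ z H1 => Hz.
have H : hassum (fun t => (bincoef 1 t.+1)%:C * z ^+ t.+1) (z * B 1).
  apply: (hassum_ext Hz) => n; rewrite !bincoef_1l exprS; ring.
move/(hassumS (fun t => (bincoef 1 t)%:C * z ^+ t)): H => H.
have := hassum_unique H1 H; rewrite bincoef0 expr0 mulr1 => E.
by rewrite mulrBr mulr1 {1}E; ring.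
Qed.

Lemma binomial_sum_subr1_le x C :
  (forall n, \sum_(k < n) `|bincoef (- x) k.+1| * rho ^+ k.+1 <= C) ->
  `|B (- x) - 1| <= C%:C.
Proof.
move=> HC; have H := (tends_shift _ _ 1).2 (BE (- x)).
apply: (tends_norm_le H) => n; rewrite addn1 big_ord_recl bincoef0 mulr1.
rewrite addrAC subrr add0r; apply: le_trans (ler_norm_sum _ _ _) _.
apply: (@le_trans _ _ (\sum_(k < n) `|bincoef (- x) k.+1| * rho ^+ k.+1)%:C).
  by rewrite rmorph_sum /=; apply: ler_sum => i _; rewrite norm_bincoef_expr.
by rewrite lecR.
Qed.

(** One factor [rho] comes out of every term and the remaining coefficients add up to at most 1. As
    [rho < 1], this places [B (- x)] in the right half-plane. *)
Lemma binomial_sum_near1 x : 0 <= x <= 1 -> `|B (- x) - 1| <= rho%:C.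
Proof.
move=> hx; have /andP[r0 r1] := rho01.
apply: binomial_sum_subr1_le => n.
apply: (@le_trans _ _ (rho * \sum_(k < n) `|bincoef (- x) k.+1|)).
  rewrite mulr_sumr; apply: ler_sum => i _; rewrite mulrC ler_wpM2r //.
  by rewrite exprS ler_piMr // exprn_ile1 // ltW.
by rewrite ler_piMr // sum_bincoefN_le1.
Qed.

(** Each coefficient is at most [x], and the powers of [rho] sum geometrically. This gives the
    continuity at 0 of [B (- x)] from the right. *)
Lemma binomial_sum_lipschitz x : 0 <= x <= 1 ->
  `|B (- x) - 1| <= (x * (1 - rho)^-1)%:C.
Proof.
move=> hx; have /andP[r0 r1] := rho01; have /andP[x0 x1] := hx.
apply: binomial_sum_subr1_le => n.
have rn k : 0 <= rho ^+ k by rewrite exprn_ge0.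
apply: le_trans (ler_wpM2l x0 (hassum_ge0_le n rn (hassum_geometric rho01))).
rewrite mulr_sumr; apply: ler_sum => i _; apply: ler_pM => //.
  exact: bincoefN_norm_le.
by rewrite exprS ler_piMl // ltW.
Qed.

Lemma Re_binomial_sum_gt0 x : 0 <= x <= 1 -> 0 < complex.Re (B (- x)).
Proof.
move=> /binomial_sum_near1 H.
have := le_trans (normc_ge_Re _) H; rewrite lecR => {}H.
have := le_lt_trans H z1; case: (B (- x)) => a b /=.
by rewrite ltr_norml; lra.
Qed.

Lemma onem_neq0 : 1 - z != 0.
Proof. exact/Re_gt0_neq0/Re_onem_gt0. Qed.

(* Equal to [1] for all [x], which is the binomial theorem. *)
Definition binomial_quot x := B (- x) * cpow (1 - z) (- x).

Local Notation g := binomial_quot.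

Lemma binomial_quotD x y : g (x + y) = g x * g y.
Proof.
rewrite /g opprD binomial_sumD cpowD ?onem_neq0 //.
by move: (cpow _ _) (cpow _ _) => a b; ring.
Qed.

Lemma binomial_quot0 : g 0 = 1.
Proof. by rewrite /g oppr0 binomial_sum0 cpow0 mulr1. Qed.

Lemma binomial_quot1 : g 1 = 1.
Proof.
have H : B (- 1) * B 1 = 1 by rewrite -binomial_sumD addNr binomial_sum0.
rewrite /g cpowN ?onem_neq0 // cpow1.
have -> : B (-1) = 1 - z.
  by rewrite -[LHS]mulr1 -[X in _ * X]binomial_sum1 mulrA H mul1r.
by rewrite divff // onem_neq0.
Qed.

(** If a b = -1, multiplying by the conjugate of b gives a |b|^2 = - conj(b), whose real parts have
    opposite signs. *)
Lemma mulc_neqN1 (a b : R[i]) : 0 < complex.Re a -> 0 < complex.Re b ->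
  a * b != - 1.
Proof.
case: a b => [a1 a2] [b1 b2] /= Ha Hb; apply/eqP => -[E1 E2].
have : 0 < a1 * (b1 ^+ 2 + b2 ^+ 2).
  by rewrite mulr_gt0 // ltr_wpDr ?sqr_ge0 // exprn_gt0.
have -> : a1 * (b1 ^+ 2 + b2 ^+ 2) =
  b1 * (a1 * b1 - a2 * b2) + b2 * (a1 * b2 + a2 * b1) by ring.
rewrite E1 E2; lra.
Qed.

Lemma binomial_quot_neqN1 x : 0 <= x <= 1 -> g x != -1.
Proof.
move=> hx; apply: mulc_neqN1; first exact: Re_binomial_sum_gt0.
by apply: Re_cpow_gt0; [exact: Re_onem_gt0|lra].
Qed.

Lemma binomial_quot_half k : g (2^-1 ^+ k) = 1.
Proof.
elim: k => [|k IH]; first by rewrite expr0 binomial_quot1.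
have : g (2^-1 ^+ k.+1) ^+ 2 = 1.
  rewrite expr2 -binomial_quotD -IH; congr g; rewrite exprS; by field.
move=> H2; have : (g (2^-1 ^+ k.+1) == 1) || (g (2^-1 ^+ k.+1) == -1).
  by rewrite -sqrf_eq1 H2.
case/orP => [/eqP|H]; first by [].
have hx : 0 <= (2^-1 : R) ^+ k.+1 <= 1.
  by rewrite exprn_ge0 //= exprn_ile1 //; lra.
by move: (binomial_quot_neqN1 hx); rewrite H.
Qed.

Lemma binomial_quot_nat x n : g x = 1 -> g (n%:R * x) = 1.
Proof.
move=> gx; elim: n => [|n IH]; first by rewrite mul0r binomial_quot0.
by rewrite -natr1 mulrDl mul1r binomial_quotD IH gx mulr1.
Qed.

Lemma binomial_quot_ge0 x : 0 <= x -> g x = 1.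
Proof.
move=> x0; pose h k : R := 2^-1 ^+ k.
have h0 k : 0 < h k by rewrite exprn_gt0.
(* [N k] is the integer part of x / 2^-k, so the remainder [r k] lies between 0 and 2^-k and
   [g x = g (r k)]. *)
pose N k := Num.truncn (x / h k); pose r k := x - (N k)%:R * h k.
have hr k : 0 <= r k <= h k.
  have xh0 : 0 <= x / h k by rewrite divr_ge0 // ltW.
  have /andP[H1 H2] := truncn_itv xh0.
  rewrite ler_pdivlMr // in H1; rewrite ltr_pdivrMr // -natr1 in H2.
  by rewrite /r /N; move: (Num.truncn _) H1 H2 => n H1 H2; lra.
have gr k : g x = g (r k).
  have -> : x = (N k)%:R * h k + r k by rewrite /r; ring.
  by rewrite binomial_quotD binomial_quot_nat ?mul1r // binomial_quot_half.
have h1 k : h k <= 1 by rewrite exprn_ile1 //; lra.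
have r1 k : 0 <= r k <= 1.
  by have := h1 k; have := hr k; lra.
have tr : tends r 0.
  have /tendsP H := tends_half; apply/tendsP => e e0; have [M HM] := H e e0.
  exists M => n Mn; apply: le_lt_trans (HM n Mn); rewrite !subr0.
  by rewrite ger0_norm ?(ger0_norm (ltW (h0 n))) //; have := hr n; lra.
(* The constant sequence [g x] equals [g (r k)], and both factors of the latter tend to 1. *)
apply: (tends_unique (tends_cst (g x))).
have BN : tends (fun k => B (- r k)) 1.
  apply: (@tends_squeeze _ _ (fun k => (1 - rho)^-1 * r k)).
    by move=> k; rewrite mulrC; exact: binomial_sum_lipschitz.
  by rewrite -(mulr0 (1 - rho)^-1); exact: tendsMl.
have CN : tends (fun k => cpow (1 - z) (- r k)) 1.
  apply: tends_cpow0; first exact: onem_neq0.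
  rewrite -(mulr0 (-1)); apply: (tends_ext (tendsMl (-1) tr)) => k.
  by rewrite mulN1r.
have := tendsM BN CN; rewrite mulr1 => H.
by apply: (tends_ext H) => k; rewrite (gr k).
Qed.

Lemma binomial_quotE x : g x = 1.
Proof.
case: (leP 0 x) => [/binomial_quot_ge0//|x0].
have xN : 0 <= - x by lra.
rewrite -[LHS]mulr1 -[X in _ * X](binomial_quot_ge0 xN).
by rewrite -binomial_quotD subrr binomial_quot0.
Qed.

End sum.

Theorem binomial_series x z : modulus z < 1 ->
  hassum (fun t => (bincoef x t)%:C * z ^+ t) (cpow (1 - z) (- x)).
Proof.
move=> z1; have [B BE] := ex_binomial_sum z1.
have := binomial_quotE z1 BE (- x); rewrite /binomial_quot !opprK => H.
suff <- : B x = cpow (1 - z) (- x) by [].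
rewrite cpowN ?(onem_neq0 z1) //; apply: (mulIf (cpow_eq0 x (onem_neq0 z1))).
by rewrite H mulVf // cpow_eq0 // onem_neq0.
Qed.

End binomial_series.

(** * The kernel *)

Lemma hassum_cvg (K : numFieldType) (f : nat -> K) (s : K) :
  hassum f s -> (series f : nat -> K^o) @ \oo --> (s : K^o).
Proof.
move=> [H]; rewrite (_ : series f = fun n => \sum_(k < n) f k) //.
by apply/funext => n; rewrite /series /= big_mkord.
Qed.

Lemma power_series_at0P (R : realType) (a : nat -> R) (f : R[i] -> R[i]) (r : R) :
  0 < r ->
  (forall u : R[i], modulus u < r -> hassum (fun t => (a t)%:C * u ^+ t) (f u)) ->
  power_series_at0 a f.
Proof.
move=> r0 H; have near_lt (K : numFieldType) (e : K) : 0 < e ->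
    \forall u \near (0 : K^o), `|u| < e.
  by move=> e0; apply: nbhs0_lt.
have rC : 0 < r%:C by rewrite ltcR.
apply: filterS (near_lt _ _ rC) => u; rewrite modulusE ltcR => /H.
exact: hassum_cvg.
Qed.

Section kernel.
Variable R : realType.
Implicit Types (x r : R) (u : R[i]).

Lemma hassum_limn (f : nat -> R) (s : R) : hassum f s ->
  cvgn (series f) /\ limn (series f) = s.
Proof.
move=> /hassum_cvg H; split; first by apply/cvg_ex; exists s.
exact: (cvg_lim _ H).
Qed.

Lemma binomial_series_real x r : 0 <= r < 1 ->
  hassum (fun t => bincoef x t * r ^+ t) ((1 - r) `^ (- x)).
Proof.
move=> /andP[r0 r1]; have := @binomial_series R x r%:C.
rewrite modulusR ger0_norm // => /(_ r1)/hassum_Re.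
have -> : 1 - r%:C = (1 - r)%:C by rewrite rmorphB.
rewrite cpow_real ?subr_gt0 //= => H; apply: (hassum_ext H) => n.
by rewrite -rmorphXn -rmorphM.
Qed.

Lemma hassum_sum (K : numFieldType) (F : nat -> nat -> K) (S : nat -> K) N :
  (forall t, hassum (F t) (S t)) ->
  hassum (fun m => \sum_(t < N) F t m) (\sum_(t < N) S t).
Proof.
move=> FS; have H := tends_sum N FS; apply: (tends_ext H) => n.
exact: exchange_big.
Qed.

Lemma hassum_bdiff (G : int -> R) u (s : R[i]) :
  (forall n, G (Negz n) = 0) ->
  hassum (fun t : nat => (G t%:Z)%:C * u ^+ t) s ->
  hassum (fun t : nat => (bdiff G t%:Z)%:C * u ^+ t) ((1 - u) * s).
Proof.
move=> G0 Gs.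
have H : hassum (fun t : nat => (G (t%:Z - 1))%:C * u ^+ t) (u * s).
  rewrite -[u * s]add0r.
  (* The shifted sequence starts with the value of [G] at -1, which is 0, so the shift multiplies
     the sum by exactly [u]. *)
  have -> : 0 = (G (0%N%:Z - 1))%:C * u ^+ 0 by rewrite G0 mul0r.
  apply/hassumS; apply: (hassum_ext (hassumZ u Gs)) => n.
  have -> : n.+1%:Z - 1 = n%:Z by lia.
  by rewrite exprS; ring.
have := hassumD Gs (hassumZ (-1) H); rewrite mulN1r mulrBl mul1r => {}H.
apply: (hassum_ext H) => n; rewrite /bdiff /backshift rmorphB /=; ring.
Qed.

Lemma hassum_iter_bdiff (G : int -> R) u (s : R[i]) k :
  (forall n, G (Negz n) = 0) ->
  hassum (fun t : nat => (G t%:Z)%:C * u ^+ t) s ->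
  hassum (fun t : nat => (iter k (@bdiff R) G t%:Z)%:C * u ^+ t)
    ((1 - u) ^+ k * s).
Proof.
move=> G0 Gs.
have iG0 j n : iter j (@bdiff R) G (Negz n) = 0.
  elim: j n => [|j IH] n //=; rewrite /bdiff /backshift IH.
  by rewrite (_ : Negz n - 1 = Negz n.+1) ?IH ?subr0 //; lia.
elim: k => [|k IH]; first by rewrite expr0 mul1r.
by rewrite exprS -mulrA /=; apply: hassum_bdiff => // n; rewrite ?iG0.
Qed.

(** * The generating function of [Bfun] *)

Section Kker.
Variables alpha nu xi : R.
Hypotheses (alpha_gt0 : 0 < alpha) (alpha_le1 : alpha <= 1) (nu_gt0 : 0 < nu)
    (xi_gt0 : 0 < xi) (xi_lt1 : xi < 1).

(** The base of the rising factorial in [Bterm]: for fixed [m] the sum over [t] produces the power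
    (1 - u)^(- x m). *)
Definition Bexponent (m : nat) : R :=
  alpha * m%:R + (Num.ceil (alpha * nu))%:~R - alpha * nu.

Local Notation x := Bexponent.
(** This radius makes 1 - r = (1 + xi) / 2, which lies strictly between [xi] and 1. *)
Local Notation r := ((1 - xi) / 2).

Lemma BtermE t m :
  Bterm alpha nu xi t m = bincoef (- nu) m * (- xi) ^+ m * bincoef (x m) t.
Proof. by []. Qed.

Lemma Bexponent_ge0 m : 0 <= x m.
Proof.
have := ceil_ge (alpha * nu); have : 0 <= alpha * m%:R by rewrite mulr_ge0 // ltW.
rewrite /x; lra.
Qed.

(** Since [alpha <= 1] and 0 < 1 - r <= 1, one has y^alpha >= (1 - r)^alpha >= 1 - r > xi. *)
Lemma xi_powR_lt1 (y : R) : 1 - r <= y -> xi * y `^ (- alpha) < 1.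
Proof.
have xi0 := xi_gt0; have xi1 := xi_lt1.
move=> hy; have y0 : 0 < y by lra.
rewrite powRN ltr_pdivrMr ?powR_gt0 // mul1r.
apply: (@lt_le_trans _ _ ((1 - r) `^ alpha)); last first.
  have r1 : 0 <= 1 - r by lra.
  by apply: (ge0_ler_powR (ltW alpha_gt0)) hy; rewrite nnegrE // ltW.
apply: (@lt_le_trans _ _ (1 - r)); first by lra.
by apply: ger1_powR => //; lra.
Qed.

(** Up to a constant power of 1 - r, this is the binomial series with parameter [- nu], taken in
    absolute values at xi (1 - r)^(-alpha) < 1. *)
Lemma ex_Bdom : exists d,
  hassum (fun m => `|bincoef (- nu) m * (- xi) ^+ m| * (1 - r) `^ (- x m)) d.
Proof.
have xi0 := xi_gt0; have xi1 := xi_lt1.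
have r1 : 0 < 1 - r by lra.
have [|d Hd] := @ex_hassum_bincoef R (- nu) (xi * (1 - r) `^ (- alpha)).
  by rewrite mulr_ge0 ?powR_ge0 ?ltW //= xi_powR_lt1.
have := hassumZ ((1 - r) `^ (alpha * nu - (Num.ceil (alpha * nu))%:~R)) Hd => H.
eexists; apply: (hassum_ext H) => m.
rewrite /x (normrM (bincoef _ _)) normrX normrN (gtr0_norm xi_gt0).
have -> : - (alpha * m%:R + (Num.ceil (alpha * nu))%:~R - alpha * nu) =
  (alpha * nu - (Num.ceil (alpha * nu))%:~R) + (- alpha) * m%:R by ring.
move: (alpha * nu - _) => e; rewrite powRD; last by apply/implyP => _; rewrite gt_eqF.
by rewrite powRrM powR_mulrn ?powR_ge0 // exprMn; ring.
Qed.

(** The exponent [x m] is nonnegative, so the inner coefficients are too, and their partial sums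
    stay below the full sum (1 - r)^(- x m). *)
Lemma norm_Bterm_sum_le m n :
  \sum_(t < n) `|Bterm alpha nu xi t m| * r ^+ t <=
  `|bincoef (- nu) m * (- xi) ^+ m| * (1 - r) `^ (- x m).
Proof.
have xi0 := xi_gt0; have xi1 := xi_lt1.
have r01 : 0 <= r < 1 by lra.
have b0 t : 0 <= bincoef (x m) t * r ^+ t.
  by rewrite mulr_ge0 ?exprn_ge0 ?bincoef_ge0 ?Bexponent_ge0 //; lra.
have := hassum_ge0_le n b0 (binomial_series_real (x m) r01) => H.
apply: le_trans (ler_wpM2l (normr_ge0 _) H).
rewrite mulr_sumr; apply: ler_sum => t _.
rewrite BtermE (normrM (_ * _ ^+ _)).
by rewrite (ger0_norm (bincoef_ge0 _ (Bexponent_ge0 m))) -mulrA.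
Qed.

Lemma hassum_Bfun t : hassum (Bterm alpha nu xi t) (Bfun alpha nu xi t%:Z).
Proof.
have xi0 := xi_gt0; have xi1 := xi_lt1.
have [d Hd] := ex_Bdom; have r0 : 0 < r by lra.
have rt0 : 0 < r ^+ t by rewrite exprn_gt0.
(* Multiplied by r^t, the term of index [m] is one summand of the inner sum bounded above; hence
   [r ^- t] times the dominating series dominates it. *)
have [|s Hs] := @ex_hassum_dom _ (Bterm alpha nu xi t) _ _ _
    (hassumZ (r ^- t) Hd).
  move=> m; rewrite ler_pdivlMl // mulrC.
  apply: le_trans (norm_Bterm_sum_le m t.+1).
  rewrite big_ord_recr /= lerDr sumr_ge0 // => i _.
  by rewrite mulr_ge0 // exprn_ge0 // ltW.
by have [_ E] := hassum_limn Hs; rewrite /Bfun E.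
Qed.

Lemma modulus_onem u : modulus u < r -> 1 - r <= modulus (1 - u).
Proof.
move=> ur; rewrite -lecR -modulusE.
apply: (@le_trans _ _ (1 - `|u|)); last by rewrite -{1}(@normr1 R[i]) lerB_dist.
by rewrite modulusE rmorphB lerD2l lerN2 lecR ltW.
Qed.

Lemma hassum_Bfun_power u : modulus u < r ->
  hassum (fun t : nat => (Bfun alpha nu xi t%:Z)%:C * u ^+ t)
    (cpow (1 - u) (alpha * nu - (Num.ceil (alpha * nu))%:~R) *
     cpow (1 + xi%:C * cpow (1 - u) (- alpha)) nu).
Proof.
have xi0 := xi_gt0; have xi1 := xi_lt1.
move=> ur; have u1 : modulus u < 1 by lra.
have v0 := Re_gt0_neq0 (Re_onem_gt0 u1).
have [d Hd] := ex_Bdom.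
(* Rows are indexed by the truncation [T] of the sum over [t]; Tannery's theorem lets [T] grow under
   the sum over [m]. *)
pose F T m := \sum_(t < T) (Bterm alpha nu xi t m)%:C * u ^+ t.
pose b m := (bincoef (- nu) m * (- xi) ^+ m)%:C.
apply: (@tannery _ F (fun m => b m * cpow (1 - u) (- x m)) _ _ _ _ _ (hassum_RC Hd)).
- move=> T m; apply: le_trans (ler_norm_sum _ _ _) _.
  apply: (@le_trans _ _ (\sum_(t < T) `|Bterm alpha nu xi t m| * r ^+ t)%:C).
    rewrite rmorph_sum /=; apply: ler_sum => t _.
    rewrite normrM normrX !modulusE modulusR -rmorphXn -rmorphM lecR.
    rewrite ler_wpM2l // lerXn2r ?nnegrE ?modulus_ge0 ?(ltW ur) //; lra.
  by rewrite lecR norm_Bterm_sum_le.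
- move=> m; apply: (tends_ext (tendsMl (b m) (binomial_series (x m) u1))) => T.
  rewrite mulr_sumr; apply: eq_bigr => t _.
  by rewrite BtermE /b (rmorphM (real_complex R) (bincoef (- nu) m * _)) /= mulrA.
- move=> T; apply: (@hassum_sum _ (fun t m => (Bterm alpha nu xi t m)%:C * u ^+ t)
    (fun t => (Bfun alpha nu xi t%:Z)%:C * u ^+ t)) => t.
  rewrite mulrC; apply: (hassum_ext (hassumZ (u ^+ t) (hassum_RC (hassum_Bfun t)))) => m.
  exact: mulrC.
(* The outer sum is the binomial series with parameter [- nu] at - xi (1 - u)^(-alpha), which must
   lie in the unit disc. *)
have w1 : modulus (- (xi%:C * cpow (1 - u) (- alpha))) < 1.
  rewrite modulusN (modulusM xi%:C) modulusR modulus_cpow.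
  by rewrite gtr0_norm // xi_powR_lt1 // modulus_onem.
have := hassumZ (cpow (1 - u) (alpha * nu - (Num.ceil (alpha * nu))%:~R))
  (binomial_series (- nu) w1); rewrite !opprK => H.
apply: (hassum_ext H) => m; rewrite /b /x.
have -> : - (alpha * m%:R + (Num.ceil (alpha * nu))%:~R - alpha * nu) =
  (alpha * nu - (Num.ceil (alpha * nu))%:~R) + (- alpha) * m%:R by ring.
move: (alpha * nu - _) => e; rewrite cpowD // cpow_nat // (rmorphM _ (bincoef _ _)) rmorphXn /= rmorphN.
rewrite -mulNr exprMn; ring.
Qed.

End Kker.
End kernel.

(** * From the generating function of [Bfun] to that of the kernel *)

Section Kker.
Variable R : realType.
Implicit Types (alpha nu xi : R) (u : R[i]).

(** With v = 1 - u, write 1 + v^alpha / xi as xi^-1 v^alpha (1 + xi v^(-alpha)). The power [nu]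
    distributes because all real parts involved are positive, and the remaining powers of v combine
    to v^(alpha nu - 1). *)
Lemma Kgenfun_factor alpha nu xi u : 0 < alpha -> alpha <= 1 -> 0 < nu ->
  0 < xi -> xi < 1 -> modulus u < (1 - xi) / 2 ->
  (xi `^ (- nu))%:C * ((1 - u) ^+ (absz (Num.ceil (alpha * nu))).-1 *
    (cpow (1 - u) (alpha * nu - (Num.ceil (alpha * nu))%:~R) *
     cpow (1 + xi%:C * cpow (1 - u) (- alpha)) nu)) = Kgenfun alpha nu xi u.
Proof.
move=> a0 a1 nu0 xi0 xi1 ur; have u1 : modulus u < 1 by lra.
have Rev := Re_onem_gt0 u1; have v0 := Re_gt0_neq0 Rev.
rewrite /Kgenfun; set v := 1 - u in Rev v0 *.
have c0 : (0 < Num.ceil (alpha * nu))%R.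
  by rewrite -(ltr_int R) (lt_le_trans (mulr_gt0 a0 nu0)) // ceil_ge.
set c := Num.ceil _ in c0 *.
(* The ceiling is at least 1, so the predecessor in [nat] is a genuine subtraction of 1. *)
have cE : (c%:~R : R) = ((absz c).-1)%:R + 1.
  by rewrite natr1 prednK ?absz_gt0 ?gt_eqF // natr_absz gtr0_norm.
have w1 : modulus (xi%:C * cpow v (- alpha)) < 1.
  rewrite (modulusM xi%:C) modulusR modulus_cpow gtr0_norm //.
  by apply: xi_powR_lt1 => //; exact: modulus_onem.
have Rew : 0 < complex.Re (1 + xi%:C * cpow v (- alpha)).
  rewrite -[X in 1 + X]opprK; apply: Re_onem_gt0; first by rewrite modulusN.
have Rea : 0 < complex.Re (cpow v alpha) by apply: Re_cpow_gt0 => //; lra.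
have va0 := Re_gt0_neq0 Rea.
have xiC : xi%:C != 0 by rewrite -modulus_gt0 modulusR normr_gt0 gt_eqF.
(* This form shows that the product has positive real part, as splitting off the factor xi^-1
   requires. *)
have E : cpow v alpha * (1 + xi%:C * cpow v (- alpha)) = xi%:C + cpow v alpha.
  by rewrite cpowN // mulrDr mulr1 mulrCA divff // mulr1 addrC.
have -> : 1 + cpow v alpha / xi%:C =
    (xi^-1)%:C * (cpow v alpha * (1 + xi%:C * cpow v (- alpha))).
  by rewrite E fmorphV; field.
have Re_xi : 0 < complex.Re (xi^-1)%:C by rewrite /= invr_gt0.
rewrite (cpowM _ Re_xi); last by rewrite E; case: (cpow v alpha) Rea => ? ? /=; lra.
rewrite (cpowM _ Rea Rew) cpow_cpow //; last by lra.
rewrite cpow_real ?invr_gt0 // -powR_inv1 ?ltW // -powRrM mulN1r.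
have -> : cpow v (alpha * nu - c%:~R) = cpow v (alpha * nu) / v / v ^+ (absz c).-1.
  rewrite cE; move: (absz c).-1 => k.
  have -> : alpha * nu - (k%:R + 1) = alpha * nu + - 1 + - (1 * k%:R) by ring.
  by rewrite (cpowD (_ + _)) // cpowD // !cpowN // cpow_nat // cpow1.
by field; rewrite v0 expf_neq0.
Qed.

Theorem Kker_power_series alpha nu xi u : 0 < alpha -> alpha <= 1 -> 0 < nu ->
  0 < xi -> xi < 1 -> modulus u < (1 - xi) / 2 ->
  hassum (fun t : nat => (Kker alpha nu xi t%:Z)%:C * u ^+ t)
    (Kgenfun alpha nu xi u).
Proof.
move=> a0 a1 nu0 xi0 xi1 ur.
have H := hassum_Bfun_power nu a0 a1 xi0 xi1 ur.
have {}H := hassum_iter_bdiff (absz (Num.ceil (alpha * nu))).-1 _ H.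
have {}H := hassumZ (xi `^ (- nu))%:C (H (fun=> erefl)).
rewrite Kgenfun_factor // in H; apply: (hassum_ext H) => t.
by rewrite /Kker rmorphM mulrA.
Qed.

End Kker.

(** * Renewal processes *)

Section discrete_law.
Context {d : measure_display} {T : measurableType d} {R : realType}.
Variable P : probability T R.
Implicit Types (A B : set T) (X : T -> nat).

Definition Pr A : R := fine (P A).

Lemma PrE A : measurable A -> P A = (Pr A)%:E.
Proof. by move=> mA; rewrite /Pr fineK // fin_num_measure. Qed.

Lemma Pr_ge0 A : 0 <= Pr A.
Proof. by rewrite fine_ge0. Qed.

Lemma Pr_bigU n (F : 'I_n -> set T) : (forall i, measurable (F i)) ->
  trivIset setT F -> Pr (\big[setU/set0]_(i < n) F i) = \sum_(i < n) Pr (F i).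
Proof.
move=> mF tF; apply: EFin_inj; rewrite -PrE; last exact: bigsetU_measurable.
rewrite measure_bigsetU_ord // -sumEFin; apply: eq_bigr => i _.
exact: PrE.
Qed.

Lemma PrD A B : measurable A -> measurable B -> B `<=` A ->
  Pr (A `\` B) = Pr A - Pr B.
Proof.
move=> mA mB BA; apply: EFin_inj; rewrite -PrE; last exact: measurableD.
rewrite measureD //; last by rewrite ltey_eq fin_num_measure.
by rewrite (setIidr BA) EFinB -!PrE.
Qed.

Lemma measurable_preimage_nat X (A : set nat) : measurable_fun setT X ->
  measurable (X @^-1` A).
Proof. by move=> mX; rewrite -[X in measurable X]setTI; exact: mX. Qed.

(** The integral is split over the level sets of [X], where the integrand is constant; the bound by
    1 makes it finite. *)
Lemma hassum_expectation X (u : R) : measurable_fun setT X -> 0 <= u <= 1 ->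
  hassum (fun s => Pr (X @^-1` [set s]) * u ^+ s)
    (fine 'E_P[fun w => u ^+ X w]).
Proof.
move=> mX /andP[u0 u1].
have mf : measurable_fun setT (fun w => (u ^+ X w)%:E).
  apply/measurable_EFinP.
  exact: (@measurableT_comp _ _ _ _ _ _ (fun n : nat => u ^+ n)).
have f0 w : (0 <= (u ^+ X w)%:E)%E by rewrite lee_fin exprn_ge0.
have mFk k : measurable (X @^-1` [set k]) by exact: measurable_preimage_nat.
have UX : setT = \bigcup_k (X @^-1` [set k]).
  by apply/seteqP; split => // w _; exists (X w).
have tX : trivIset setT (fun k => X @^-1` [set k]).
  by move=> i j _ _ [w [/= <- <-]].
have EX : ('E_P[fun w => (u ^+ X w)%R] =
    \sum_(0 <= k <oo) (Pr (X @^-1` [set k]) * u ^+ k)%:E)%E.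
  rewrite unlock [in LHS]UX ge0_integral_bigcup // -?UX //.
  apply: eq_eseriesr => k _.
  rewrite (eq_integral (cst (u ^+ k)%:E)); last first.
    by move=> w; rewrite inE /= => ->.
  transitivity ((u ^+ k)%:E * P (X @^-1` [set k]))%E; first exact: integral_cst.
  by rewrite PrE // -EFinM mulrC.
have E1 : ('E_P[fun w => (u ^+ X w)%R] <= 1)%E.
  rewrite unlock; apply: (@le_trans _ _ (\int[P]_w (cst 1%E w))%E).
    by apply: ge0_le_integral => // w _; rewrite lee_fin exprn_ile1.
  apply: (@le_trans _ _ (1 * P setT)%E); first by rewrite integral_cst.
  by rewrite mul1e probability_setT.
have E0 : (0 <= 'E_P[fun w => (u ^+ X w)%R])%E by exact: expectation_ge0.
have Efin : ('E_P[fun w => (u ^+ X w)%R] \is a fin_num)%E.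
  by rewrite ge0_fin_numE // (le_lt_trans E1) // ltry.
have nn k : (0 <= (Pr (X @^-1` [set k]) * u ^+ k)%:E)%E.
  by rewrite lee_fin mulr_ge0 ?exprn_ge0 ?Pr_ge0.
have := @is_cvg_nneseries R (fun k => (Pr (X @^-1` [set k]) * u ^+ k)%:E)
  xpredT 0%N (fun n _ _ => nn n).
rewrite -[X in X -> _]/(cvg _) => /cvg_ex[l Hl].
have lE : l = (fine 'E_P[fun w => u ^+ X w])%:E.
  by rewrite fineK // EX; apply/esym/cvg_lim.
rewrite lE in Hl; have [_ H] := (fine_cvgP _ _).1 Hl.
split; move: H; set v := fine \o _; suff -> : v = fun n =>
    \sum_(k < n) Pr (X @^-1` [set (k : nat)]) * u ^+ k by [].
by apply/funext => n; rewrite /v /= sumEFin /= big_mkord.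
Qed.

End discrete_law.

(** * Laws of the arrival times and state probabilities *)

Section renewal.
Context {d : measure_display} {T : measurableType d} {R : realType}.
Variables (P : probability T R) (Z : nat -> T -> nat).
Hypothesis mZ : forall j, measurable_fun setT (Z j).
Hypothesis Z_gt0 : forall j w, (0 < Z j w)%N.
Hypothesis Zindep : mutually_independent P Z.
Hypothesis Zid : identically_distributed P Z.

Definition seq_conv (f g : nat -> R) (t : nat) : R :=
  \sum_(k < t.+1) f k * g (t - k)%N.

Definition waiting_pmf (s : nat) : R := Pr P (Z 0%N @^-1` [set s]).

Definition arrival_pmf (n s : nat) : R := Pr P (arrival Z n @^-1` [set s]).

Lemma arrivalS n w : arrival Z n.+1 w = (arrival Z n w + Z n w)%N.
Proof. by rewrite /arrival big_ord_recr. Qed.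

Lemma arrivalS_preimage n s : arrival Z n.+1 @^-1` [set s] =
  \big[setU/set0]_(k < s.+1)
    (arrival Z n @^-1` [set (s - k)%N] `&` Z n @^-1` [set (k : nat)]).
Proof.
rewrite -bigcup_mkord_ord; apply/seteqP; split => w /=.
  rewrite arrivalS => <-; exists (Z n w) => /=.
    by rewrite ltnS leq_addl.
  by rewrite inordK ?ltnS ?leq_addl // addnK.
move=> [k ks [H1 H2]]; rewrite arrivalS H1 H2 subnK //.
by rewrite -ltnS.
Qed.

Lemma measurable_arrival n (A : set nat) : measurable (arrival Z n @^-1` A).
Proof.
have mA s : measurable (arrival Z n @^-1` [set s]).
  elim: n s => [|n IH] s.
    rewrite /arrival; under eq_fun do rewrite big_ord0.
    exact: (measurable_preimage_nat _ (measurable_cst _)).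
  rewrite arrivalS_preimage; apply: bigsetU_measurable => k _.
  by apply: measurableI => //; exact: measurable_preimage_nat.
have -> : arrival Z n @^-1` A = \bigcup_(s in A) arrival Z n @^-1` [set s].
  by apply/seteqP; split => w /=; [move=> Aw; exists (arrival Z n w)|case=> s As ->].
by apply: bigcup_measurable => s _.
Qed.

Lemma waiting_pmfE n k : Pr P (Z n @^-1` [set k]) = waiting_pmf k.
Proof. by rewrite /waiting_pmf /Pr (Zid n 0%N). Qed.

Lemma arrival_step n s (E : set T) : measurable E ->
  Pr P (arrival Z n.+1 @^-1` [set s] `&` E) =
  \sum_(k < s.+1) Pr P (arrival Z n @^-1` [set (s - k)%N] `&`
                        (Z n @^-1` [set (k : nat)] `&` E)).
Proof.
move=> mE; rewrite arrivalS_preimage big_distrl /= Pr_bigU.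
- by apply: eq_bigr => k _; rewrite setIA.
- move=> k; apply: measurableI => //; apply: measurableI.
    exact: measurable_arrival.
  exact: measurable_preimage_nat.
- move=> i j _ _ [w [[[_ /= H1] _] [[_ /= H2] _]]].
  by apply/val_inj; rewrite /= -H1 -H2.
Qed.

(* Generalizes the law of the n-th arrival time so that the independence of
   the later waiting times is available in the induction. *)
Lemma arrival_indep n s (J : {fset nat}) (A : nat -> set nat) :
  (forall j, j \in J -> (n <= j)%N) ->
  Pr P (arrival Z n @^-1` [set s] `&`
        \bigcap_(j in [set` J]) (Z j @^-1` A j)) =
  iter n (seq_conv waiting_pmf) (fun s => (s == 0%N)%:R) s *
  \prod_(j <- J) Pr P (Z j @^-1` A j).
Proof.
elim: n s J A => [|n IH] s J A nJ /=.
  have -> : arrival Z 0 @^-1` [set s] = if s == 0%N then setT else set0.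
    apply/seteqP; split => w; rewrite /= /arrival big_ord0; first by move=> <-.
    by case: eqP => [->|].
  case: eqP => _; last by rewrite set0I /Pr measure0 mul0r.
  by rewrite setTI mul1r; exact: Zindep.
rewrite arrival_step; last first.
  apply: fin_bigcap_measurable; first exact: finite_fset.
  by move=> j _; exact: measurable_preimage_nat.
rewrite /seq_conv mulr_suml; apply: eq_bigr => k _.
have nNJ : n \notin J by apply/negP => /nJ; rewrite ltnn.
(* The event that [Z n] equals [k] joins the others at index [n], which is outside [J], so the
   induction hypothesis applies to the enlarged set. *)
pose A' j := if j == n then [set (k : nat)] else A j.
have -> : Z n @^-1` [set (k : nat)] `&` \bigcap_(j in [set` J]) (Z j @^-1` A j) =
    \bigcap_(j in [set` (n |` J)%fset]) (Z j @^-1` A' j).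
  rewrite set_fsetU1 bigcap_setU1 {1}/A' eqxx; congr (_ `&` _).
  apply: eq_bigcapr => j /= jJ; rewrite /A'; case: eqP => // jn.
  by rewrite jn (negbTE nNJ) in jJ.
rewrite IH; last first.
  by move=> j; rewrite in_fset1U => /orP[/eqP -> //|/nJ/ltnW].
rewrite big_fsetU1 //= {1}/A' eqxx waiting_pmfE mulrCA mulrA.
congr (_ * _); apply: eq_big_seq => j jJ; rewrite /A'; case: eqP => // jn.
by rewrite jn (negbTE nNJ) in jJ.
Qed.

Lemma arrival_pmfE n s :
  arrival_pmf n s = iter n (seq_conv waiting_pmf) (fun s => (s == 0%N)%:R) s.
Proof.
have := @arrival_indep n s fset0 (fun=> setT) (fun j => _).
rewrite big_seq_fset0 mulr1 => <- //; congr (Pr P _).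
by rewrite [X in _ `&` X](_ : _ = setT) ?setIT //; apply/seteqP; split.
Qed.

Lemma Pr_arrival_le n t :
  Pr P [set w | (arrival Z n w <= t)%N] = \sum_(s < t.+1) arrival_pmf n s.
Proof.
have -> : [set w | (arrival Z n w <= t)%N] =
    \big[setU/set0]_(s < t.+1) (arrival Z n @^-1` [set (s : nat)]).
  rewrite -bigcup_mkord_ord; apply/seteqP; split => w /=.
    move=> H; exists (arrival Z n w) => //=; first by rewrite inordK.
  by move=> [s st /= ->]; rewrite inordK.
rewrite Pr_bigU //; first by move=> s; exact: measurable_arrival.
by move=> i j _ _ [w [/= H1 H2]]; apply/val_inj; rewrite /= -H1 -H2.
Qed.

(** The event is J_n <= t with J_(n+1) <= t removed, and the latter is contained in the former
    because J_n <= J_(n+1). *)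
Lemma state_probE (n t : nat) : state_prob P Z n%:Z t%:Z =
  \sum_(s < t.+1) arrival_pmf n s - \sum_(s < t.+1) arrival_pmf n.+1 s.
Proof.
rewrite -!Pr_arrival_le -PrD.
- rewrite /= /Pr; congr (fine (P _)); apply/seteqP; split => w /=.
    by move=> /andP[-> H]; split => //; apply/negP; rewrite -ltnNge.
  by move=> [-> /negP]; rewrite -ltnNge.
- exact: (measurable_arrival n [set k | (k <= t)%N]).
- exact: (measurable_arrival n.+1 [set k | (k <= t)%N]).
- move=> w /=; rewrite arrivalS; apply: leq_trans; exact: leq_addr.
Qed.

End renewal.

(** * Convolution of sequences *)

Section convolution.
Variable R : realType.
Implicit Types (f g h : nat -> R).

(** Truncation to polynomials lets convolution inherit commutativity and associativity from
    polynomial multiplication. *)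
Lemma seq_conv_coef f g N t : (t < N)%N ->
  seq_conv f g t = ((\poly_(i < N) f i) * (\poly_(i < N) g i))`_t.
Proof.
move=> tN; rewrite coefM; apply: eq_bigr => k _; rewrite !coef_poly.
have kt : (k <= t)%N by rewrite -ltnS.
by rewrite (leq_ltn_trans kt tN) (leq_ltn_trans (leq_subr _ _) tN).
Qed.

Lemma convC f g : seq_conv f g = seq_conv g f.
Proof. by apply/funext => t; rewrite !(@seq_conv_coef _ _ t.+1) // mulrC. Qed.

Lemma convA f g h : seq_conv f (seq_conv g h) = seq_conv (seq_conv f g) h.
Proof.
apply/funext => t; pose p (f : nat -> R) := \poly_(i < t.+1) f i.
transitivity ((p f * (p g * p h))`_t); last rewrite mulrA.
  rewrite coefM; apply: eq_bigr => k _.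
  by rewrite coef_poly ltn_ord -seq_conv_coef // ltnS leq_subr.
rewrite coefM; apply: eq_bigr => k _.
by rewrite /p [X in _ * X = _]coef_poly ltnS leq_subr -seq_conv_coef.
Qed.

Lemma convBr f g h t :
  seq_conv f (fun s => g s - h s) t = seq_conv f g t - seq_conv f h t.
Proof. by rewrite /seq_conv -sumrB; apply: eq_bigr => k _; rewrite mulrBr. Qed.

Lemma conv_delta f : seq_conv f (fun s => (s == 0%N)%:R) = f.
Proof.
apply/funext => t; rewrite convC /seq_conv big_ord_recl subn0 mul1r big1 ?addr0 //.
by move=> i _; rewrite mul0r.
Qed.

Lemma conv_cst1 f t : seq_conv (fun=> 1) f t = \sum_(s < t.+1) f s.
Proof.
rewrite convC /seq_conv; apply: eq_bigr => k _; exact: mulr1.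
Qed.

Lemma conv_theta f t :
  seq_conv (fun k => (0 < k)%N%:R) f t = if t is t'.+1 then \sum_(s < t'.+1) f s else 0.
Proof.
rewrite /seq_conv big_ord_recl mul0r add0r; case: t => [|t]; first by rewrite big_ord0.
rewrite -conv_cst1; apply: eq_bigr => k _.
by rewrite lift0 subSS.
Qed.

(** Partial summation is convolution with the constant 1, so it commutes with convolution by [K] and
    is undone by the difference. *)
Lemma bdiff_conv_sum (K f : nat -> R) t :
  seq_conv K (fun t => \sum_(s < t.+1) f s) t -
    (if t is t'.+1 then seq_conv K (fun t => \sum_(s < t.+1) f s) t' else 0) =
  seq_conv K f t.
Proof.
have -> : (fun t => \sum_(s < t.+1) f s) = seq_conv (fun=> 1) f.
  by apply/funext => s; rewrite conv_cst1.
rewrite convA (convC K) -convA !conv_cst1; case: t => [|t].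
  by rewrite big_ord1 subr0.
by rewrite conv_cst1 big_ord_recr /= addrAC subrr add0r.
Qed.

Lemma power_series_uniq_real (c : nat -> R) (r : R) : 0 < r ->
  (forall u, 0 < u < r -> hassum (fun t => c t * u ^+ t) 0) ->
  forall t, c t = 0.
Proof.
(* Convergence at [2 * rho < r] bounds the terms there, so at [rho] they are dominated by a
   geometric series of ratio 1/2. The points tending to 0 will be rho 2^-n. *)
move=> r0 cu; pose rho := r / 4.
have rho0 : 0 < rho by rewrite divr_gt0.
have h2 : 0 < 2 * rho < r by rewrite /rho; lra.
have [C HC] := hassum_bounded (cu _ h2).
have half0 : 0 <= (2^-1 : R) < 1 by rewrite invr_ge0 ler0n invf_lt1 ?ltr1n.
have [|d Hd] := @ex_hassum_dom _ (fun t => `|c t| * rho ^+ t) _ _ _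
    (hassumZ C (hassum_geometric half0)).
  move=> t; rewrite normrM normr_id (ger0_norm (exprn_ge0 _ (ltW rho0))).
  rewrite exprVn ler_pdivlMr ?exprn_gt0 // -mulrA -exprMn mulrC.
  have h0 : 0 <= (2 * rho) ^+ t by apply: exprn_ge0; rewrite mulr_ge0 ?ltW.
  have := HC t; rewrite normrM (ger0_norm h0).
  by rewrite mulrC [rho * 2]mulrC.
have hn n : (0 < (2^-1 : R) ^+ n) && ((2^-1 : R) ^+ n <= 1).
  by rewrite exprn_gt0 //= exprn_ile1 ?invr_ge0 ?ler0n // invf_le1 ?ler1n.
apply: (@power_series_eq0 _ c (fun n => rho * 2^-1 ^+ n) rho d) => //.
- by rewrite -(mulr0 rho); apply: tendsMl; exact: tends_half.
- by move=> n; have /andP[h0 _] := hn n; rewrite mulf_neq0 ?gt_eqF.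
- move=> n; have /andP[h0 h1] := hn n.
  by rewrite gtr0_norm ?mulr_gt0 // ler_piMr // ltW.
- move=> n; have /andP[h0 h1] := hn n; apply: cu; rewrite mulr_gt0 //=.
  apply: (@le_lt_trans _ _ rho); last by rewrite /rho; lra.
  by rewrite ler_piMr // ltW.
Qed.

End convolution.

(** * The Kolmogorov-Feller equations *)

Section PDTP.
Variables (R : realType) (alpha nu xi : R).
Hypotheses (alpha_gt0 : 0 < alpha) (alpha_le1 : alpha <= 1) (nu_gt0 : 0 < nu)
    (xi_gt0 : 0 < xi) (xi_lt1 : xi < 1).

Lemma Kgenfun_real (u : R) : u < 1 -> Kgenfun alpha nu xi u%:C =
  ((1 - u)^-1 * (1 + (1 - u) `^ alpha / xi) `^ nu)%:C.
Proof.
move=> u1; have v0 : 0 < 1 - u by lra.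
rewrite /Kgenfun; have -> : 1 - u%:C = (1 - u)%:C by rewrite rmorphB.
rewrite cpow_real //.
have -> : 1 + ((1 - u) `^ alpha)%:C / xi%:C = (1 + (1 - u) `^ alpha / xi)%:C.
  by rewrite rmorphD rmorphM fmorphV.
rewrite cpow_real; last by rewrite ltr_wpDr // divr_ge0 ?powR_ge0 // ltW.
by rewrite rmorphM fmorphV.
Qed.

Lemma PDTP_genfun_real (u : R) : u < 1 -> PDTP_genfun alpha nu xi u%:C =
  (xi `^ nu * u / (xi + (1 - u) `^ alpha) `^ nu)%:C.
Proof.
move=> u1; have v0 : 0 < 1 - u by lra.
rewrite /PDTP_genfun; have -> : 1 - u%:C = (1 - u)%:C by rewrite rmorphB.
rewrite cpow_real // -rmorphD cpow_real; last by rewrite ltr_wpDr ?powR_ge0.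
by rewrite !rmorphM fmorphV.
Qed.

(** As xi + (1 - u)^alpha = xi (1 + (1 - u)^alpha / xi), the powers with exponent [nu] cancel. *)
Lemma Kgenfun_PDTP_genfun_real (u : R) : u < 1 ->
  ((1 - u)^-1 * (1 + (1 - u) `^ alpha / xi) `^ nu) *
  (xi `^ nu * u / (xi + (1 - u) `^ alpha) `^ nu) = u / (1 - u).
Proof.
move=> u1; have p0 := powR_ge0 (1 - u) alpha; have xi0 := xi_gt0.
have -> : xi + (1 - u) `^ alpha = (1 + (1 - u) `^ alpha / xi) * xi.
  by field; rewrite gt_eqF.
have a0 : 0 < 1 + (1 - u) `^ alpha / xi by rewrite ltr_wpDr // divr_ge0 // ltW.
rewrite powRM ?ltW //; move: (_ `^ nu) (_ `^ nu) (powR_gt0 nu a0) (powR_gt0 nu xi0).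
by move=> a b a1 b1; field; rewrite !gt_eqF // subr_gt0.
Qed.

Context {d : measure_display} {T : measurableType d}.
Variables (P : probability T R) (Z : nat -> T -> nat).
Hypothesis hZ : is_PDTP alpha nu xi P Z.

Let K (t : nat) := Kker alpha nu xi t%:Z.
Let p := @waiting_pmf _ _ _ P Z.

Lemma waiting_pmf_hassum (u : R) : 0 <= u < 1 ->
  hassum (fun s => p s * u ^+ s)
    (xi `^ nu * u / (xi + (1 - u) `^ alpha) `^ nu).
Proof.
move=> /andP[u0 u1]; case: hZ => mZ _ _ _ gZ.
have := gZ 0%N u%:C; rewrite PDTP_genfun_real // modulusE modulusR ger0_norm //.
rewrite lecR => /(_ (ltW u1))/(congr1 (@complex.Re R)) /= <-.
have -> : (fun w => complex.Re (u%:C ^+ Z 0%N w)) = (fun w => u ^+ Z 0%N w).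
  by apply/funext => w; rewrite -rmorphXn.
by apply: hassum_expectation; rewrite ?u0 ?ltW.
Qed.

Lemma conv_waiting_pmf_Kker t : seq_conv p K t = (0 < t)%N%:R.
Proof.
apply/eqP; rewrite -subr_eq0; apply/eqP.
have xi1 := xi_lt1; have xi0 := xi_gt0; have r0 : 0 < (1 - xi) / 2 by lra.
apply: (@power_series_uniq_real _ (fun t => seq_conv p K t - (0 < t)%N%:R) _ r0).
move=> u /andP[u0 ur]; have u1 : u < 1 by lra.
have u01 : 0 <= u < 1 by rewrite ltW.
have Hp := waiting_pmf_hassum u01.
have uC : modulus u%:C < (1 - xi) / 2 by rewrite modulusR gtr0_norm.
have := Kker_power_series alpha_gt0 alpha_le1 nu_gt0 xi_gt0 xi_lt1 uC.
rewrite Kgenfun_real // => /hassum_Re HK.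
have {}HK : hassum (fun t => K t * u ^+ t)
    ((1 - u)^-1 * (1 + (1 - u) `^ alpha / xi) `^ nu).
  by apply: (hassum_ext HK) => n; rewrite -rmorphXn -rmorphM.
have [C HC] := hassum_partial_bounded HK.
(* For u > 0 the terms of the waiting-time series are nonnegative, so the series dominates itself in
   the Cauchy product. *)
have pD m : `|p m * u ^+ m| <= p m * u ^+ m.
  by rewrite ger0_norm // mulr_ge0 ?exprn_ge0 ?Pr_ge0 // ltW.
have := mertens pD Hp HC Hp HK.
rewrite mulrC Kgenfun_PDTP_genfun_real // => H1.
have H2 : hassum (fun t => (0 < t)%N%:R * u ^+ t) (u / (1 - u)).
  rewrite -[u / _]add0r; have {1}-> : 0 = (0 < 0)%N%:R * u ^+ 0 by rewrite mul0r.
  apply/(hassumS (fun t => (0 < t)%N%:R * u ^+ t)).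
  apply: (hassum_ext (hassumZ u (hassum_geometric u01))) => n.
  by rewrite mul1r exprS.
have := hassumD H1 (hassumZ (-1) H2); rewrite mulN1r subrr => H.
apply: (hassum_ext H) => n; rewrite mulrBl mulN1r /seq_conv mulr_suml; congr (_ - _).
apply: eq_bigr => k _; have -> : u ^+ n = u ^+ k * u ^+ (n - k)%N.
  by rewrite -exprD subnKC // -ltnS.
by ring.
Qed.

Let Q := arrival_pmf P Z.

Lemma arrival_pmf0 : Q 0 = fun s => (s == 0%N)%:R.
Proof. by case: hZ => mZ _ iZ dZ _; apply/funext => s; rewrite /Q arrival_pmfE. Qed.

Lemma arrival_pmfS n : Q n.+1 = seq_conv p (Q n).
Proof.
case: hZ => mZ _ iZ dZ _; apply/funext => s; rewrite /Q arrival_pmfE //=.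
by congr seq_conv; apply/funext => k; rewrite arrival_pmfE.
Qed.

(** Associativity moves one factor [p] of the arrival law onto [K], which it turns into the
    indicator of t >= 1. *)
Lemma conv_Kker_arrival_pmfS n t : seq_conv K (Q n.+1) t =
  if t is t'.+1 then \sum_(s < t'.+1) Q n s else 0.
Proof.
rewrite arrival_pmfS convA (convC K) -conv_theta; congr (seq_conv _ _ _).
by apply/funext => k; exact: conv_waiting_pmf_Kker.
Qed.

Lemma state_prob_Kolmogorov_Feller (n t : nat) :
  bdiff (convol (Kker alpha nu xi) (state_prob P Z n%:Z)) t%:Z =
  state_prob P Z (n%:Z - 1) (t%:Z - 1) +
  (n == 0%N)%:R * (Kker alpha nu xi t%:Z - Theta R (t%:Z - 1)).
Proof.
have [mZ pZ iZ dZ _] := hZ.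
pose S m s := \sum_(i < s.+1) Q m i.
have stE m s : state_prob P Z m%:Z s%:Z = S m s - S m.+1 s.
  by rewrite state_probE.
have convolE s : convol (Kker alpha nu xi) (state_prob P Z n%:Z) s%:Z =
    seq_conv K (S n) s - seq_conv K (S n.+1) s.
  rewrite -convBr; apply: eq_bigr => k _; rewrite subzn; last by rewrite -ltnS.
  by rewrite stE.
(* State probabilities are differences of partial sums of arrival laws, so the backward difference
   undoes the summation; at t = 0 the value at -1 is 0. *)
have -> : bdiff (convol (Kker alpha nu xi) (state_prob P Z n%:Z)) t%:Z =
    seq_conv K (Q n) t - seq_conv K (Q n.+1) t.
  rewrite -(bdiff_conv_sum K (Q n)) -(bdiff_conv_sum K (Q n.+1)).
  rewrite -/(S n) -/(S n.+1) /bdiff /backshift convolE.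
  case: t => [|t]; first by rewrite (_ : 0%N%:Z - 1 = Negz 0) // !subr0.
  by rewrite (_ : t.+1%:Z - 1 = t%:Z) ?convolE; [ring|lia].
have tE s : s.+1%:Z - 1 = s%:Z by lia.
(* For n = 0 the law [Q 0] is the convolution unit, leaving the kernel minus the step function. For
   n > 0 both convolutions are partial sums of arrival laws up to t - 1, whose difference is the
   preceding state probability. *)
rewrite conv_Kker_arrival_pmfS; case: n => [|n] in stE convolE *.
  rewrite arrival_pmf0 conv_delta mul1r /= add0r; congr (_ - _).
  case: t => [|t]; rewrite /Theta ?tE //.
  rewrite big_ord_recl big1 ?addr0 //.
rewrite conv_Kker_arrival_pmfS mul0r addr0 tE.
by case: t => [|t]; rewrite ?subrr // tE stE.
Qed.

End PDTP.

Local Close Scope complex_scope.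

Theorem mainTheorem8 (R : realType) (alpha nu xi : R)
    (alpha_gt0 : 0 < alpha) (alpha_le1 : alpha <= 1) (nu_gt0 : 0 < nu)
    (xi_gt0 : 0 < xi) (xi_lt1 : xi < 1) :
  [/\ (* the series defining B converge *)
      forall t : nat, cvgn (series (Bterm alpha nu xi t)),
      power_series_at0 (fun t : nat => Kker alpha nu xi t%:Z)
        (Kgenfun alpha nu xi)
    & forall (d : measure_display) (T : measurableType d)
        (P : probability T R) (Z : nat -> T -> nat),
        is_PDTP alpha nu xi P Z ->
        forall n t : nat,
          bdiff (convol (Kker alpha nu xi) (state_prob P Z n%:Z)) t%:Z =
          state_prob P Z (n%:Z - 1) (t%:Z - 1) +
          (n == 0%N)%:R * (Kker alpha nu xi t%:Z - Theta R (t%:Z - 1))].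
Proof.
split.
- move=> t; have Bt := hassum_Bfun nu alpha_gt0 alpha_le1 xi_gt0 xi_lt1 t.
  by have [] := hassum_limn Bt.
- have r0 : 0 < (1 - xi) / 2 by rewrite divr_gt0 // subr_gt0.
  by apply: (power_series_at0P r0) => u ur; exact: Kker_power_series.
- move=> d T P Z hZ n t; exact: state_prob_Kolmogorov_Feller.
Qed.
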